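(* Let $(X,\mu)$ be a non-atomic probability measure space and let $\mathcal{T}$ be a tree on $X$ with associated dyadic maximal operator $\mathcal{M}_{\mathcal{T}}$. Let $g,h:(0,1]\to[0,+\infty)$ be non-increasing integrable functions and let $G:[0,+\infty)\to[0,+\infty)$ be a non-decreasing function. Then for every $k\in(0,1]$, $$\sup\left\{\int_K G\big[(\mathcal{M}_{\mathcal{T}}\phi)^\ast(t)\big]\,h(t)\,dt\ :\ \phi\in L^1(X,\mu),\ \phi\ge 0,\ \phi^\ast=g,\ K\subseteq[0,1]\text{ measurable with }|K|=k\right\}$$ $$=\int_0^k G\left(\frac1t\int_0^t g(u)\,du\right)h(t)\,dt,$$ where both sides are elements of $[0,+\infty]$.
   Context: Tree: a set $\mathcal{T}$ of measurable subsets of $X$ is called a tree if: (1) $X\in\mathcal{T}$ and $\mu(I)>0$ for every $I\in\mathcal{T}$; (2) to every $I\in\mathcal{T}$ there corresponds a finite or countable subset $C(I)\subseteq\mathcal{T}$ containing at least two elements, such that the elements of $C(I)$ are pairwise disjoint subsets of $I$ and $I=\bigcup C(I)$; (3) $\mathcal{T}=\bigcup_{m\ge0}\mathcal{T}_{(m)}$, where $\mathcal{T}_{(0)}=\{X\}$ and $\mathcal{T}_{(m+1)}=\bigcup_{I\in\mathcal{T}_{(m)}}C(I)$; (4) $\lim_{m\to\infty}\sup_{I\in\mathcal{T}_{(m)}}\mu(I)=0$. Dyadic maximal operator: for $\phi\in L^1(X,\mu)$, $\mathcal{M}_{\mathcal{T}}\phi(x)=\sup\left\{\frac{1}{\mu(I)}\int_I|\phi|\,d\mu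 : x\in I\in\mathcal{T}\right\}$. For a measurable function $\psi$ on $X$, $\psi^\ast$ is its non-increasing rearrangement on $(0,1]$, i.e. the non-increasing function equimeasurable with $|\psi|$, for instance $\psi^\ast(t)=\inf\{s\ge0:\mu(\{|\psi|>s\})\le t\}$. Equalities between rearrangements (such as $\phi^\ast=g$) are understood almost everywhere. $|K|$ denotes Lebesgue measure. *)

(* Defs.v *)
From HB Require Import structures.
From mathcomp Require Import all_boot all_order all_algebra.
From mathcomp Require Import all_classical all_reals all_analysis.

Set Implicit Arguments.
Unset Strict Implicit.
Unset Printing Implicit Defensive.

Import Order.TTheory GRing.Theory Num.Theory.
Import numFieldNormedType.Exports.

Local Open Scope classical_set_scope.
Local Open Scope ring_scope.

Definition nonatomic d (X : measurableType d) (R : realType)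
    (mu : {measure set X -> \bar R}) : Prop :=
  forall A : set X, measurable A -> (0 < mu A)%E ->
    exists B : set X,
      [/\ measurable B, B `<=` A, (0 < mu B)%E & (mu B < mu A)%E].

Fixpoint tree_level (X : Type) (C : set X -> set (set X)) (m : nat) :
    set (set X) :=
  if m is m'.+1 then \bigcup_(I in tree_level C m') C I else [set setT].

Definition tree_children (X : Type) (T : set (set X))
    (C : set X -> set (set X)) : Prop :=
  forall I, T I ->
    [/\ C I `<=` T,
        countable (C I),
        exists A B, [/\ C I A, C I B & A <> B],
        trivIset (C I) id &
        I = \bigcup_(A in C I) A].

Definition is_tree d (X : measurableType d) (R : realType)
    (mu : {measure set X -> \bar R}) (T : set (set X)) : Prop :=
  [/\ forall I, T I -> measurable I,
      T setT,
      forall I, T I -> (0 < mu I)%E &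
      exists C : set X -> set (set X),
        [/\ tree_children T C,
            T = \bigcup_m tree_level C m &
            (fun m => ereal_sup [set mu I | I in tree_level C m])
              @ \oo --> 0%E]].

(* Extended-real valued, since the supremum may be infinite on a null set. *)
Definition dyadic_maximal d (X : measurableType d) (R : realType)
    (mu : {measure set X -> \bar R}) (T : set (set X)) (phi : X -> R) :
    X -> \bar R :=
  fun x => ereal_sup
    [set ((\int[mu]_(y in I) `|phi y|%:E) / mu I)%E | I in
      [set I | T I /\ I x]].

Definition rearrangement d (X : measurableType d) (R : realType)
    (mu : {measure set X -> \bar R}) (psi : X -> \bar R) (t : R) : \bar R :=
  ereal_inf [set s%:E | s in
    [set s : R | 0 <= s /\ (mu [set x | (s%:E < `|psi x|)%E] <= t%:E)%E]].

(* Main.v *)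
(* Upper bound: {M phi > s} is a disjoint union of cells on which the average of
   phi exceeds s, so the Hardy-Littlewood inequality gives
   (M phi)^*(t) <= t^-1 \int_0^t g; an integral over K of a non-increasing
   function is at most its integral over (0, k].

   Lower bound: take K = (0, k] and fix a < 1. A cell contains disjoint subcells
   of total relative measure exactly a; iterating this N times produces a
   variable V, uniform on (0, 1], and for every m <= N disjoint cells of total
   measure a^m in each of which V is uniform on (0, a^m]. For phi = g o V this
   gives (M phi)^*(t) >= (a/t) \int_0^(t/a) g for a^(N+1) <= t < 1 with t/a <= 1.
   Since h is non-increasing, dilating by a yields at least a times the integral
   over (a^N, k]; let N tend to infinity, then a to 1. *)
Require Import Defs.
From HB Require Import structures.
From mathcomp Require Import all_boot all_order all_algebra.
From mathcomp Require Import all_classical all_reals all_analysis.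
From mathcomp Require Import measurable_realfun ring lra.

Set Implicit Arguments.
Unset Strict Implicit.
Unset Printing Implicit Defensive.

Import Order.TTheory GRing.Theory Num.Theory.
Import numFieldNormedType.Exports.

Local Open Scope classical_set_scope.
Local Open Scope ring_scope.

(** [G] may jump, so a lower bound for the rearranged maximal function that merely approaches
    [hardy g t] could not be passed through [G]. The bound is therefore an exact value of [hardy g],
    taken at the dilated point t/a; the loss falls on the measure dt and becomes a factor a outside
    the integral.

    The tree dictates the measures of its cells, so an exact proportion a comes in general only from
    infinite unions of cells. Points are coded by a real [e x] with null level sets and with every
    set where [e] is below t a union of cells; quantiles of [e] then realise every proportion, and
    its distribution function supplies the uniform variables.

    One [phi] has to serve all scales a^m at once. Hence the recursion works inside the chosen
    cells, where V is a rescaled copy of the variable already built there, and the rest of the cell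
    receives the values in (a, 1]. A finite depth N avoids taking a limit of such variables.

    The condition on [phi] fixes its rearrangement only almost everywhere; it is exchanged for the
    equality of laws [equidistributed], in one direction for each bound. *)

Lemma countable_family_seq (X : Type) (A : set (set X)) :
  countable A -> exists F : nat -> set X,
    [/\ forall n, F n = set0 \/ A (F n),
        forall J, A J -> exists n, F n = J &
        trivIset A id -> trivIset setT F].
Proof.
move=> /countable_injP[f finj].
pose F n := \bigcup_(J in A `&` f @^-1` [set n]) J.
have FE J : A J -> F (f J) = J.
  move=> AJ; apply/seteqP; split=> [x [J' [AJ' /= fJ'] J'x]|x Jx].
    by rewrite -(finj _ _ _ _ fJ') ?inE.
  by exists J.
have F0A n : F n = set0 \/ exists J, [/\ A J, f J = n & F n = J].
  have [[J [AJ fJ]]|nJ] := pselect (exists J, A J /\ f J = n).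
    by right; exists J; split=> //; rewrite -fJ FE.
  left; apply/seteqP; split=> // x [J [AJ /= fJ] _].
  by apply: nJ; exists J.
exists F; split.
- by move=> n; have [->|[J [AJ _ ->]]] := F0A n; [left|right].
- by move=> J AJ; exists (f J); exact: FE.
- move=> tA i j _ _ [x [Fix Fjx]].
  have [F0|[J [AJ fJ FJ]]] := F0A i; first by rewrite F0 in Fix.
  have [F0|[J' [AJ' fJ' FJ']]] := F0A j; first by rewrite F0 in Fjx.
  rewrite -fJ -fJ' (tA J J') //.
  by exists x; split; [rewrite /= -FJ|rewrite /= -FJ'].
Qed.

Lemma bigcup_family_seq (X : Type) (A : set (set X)) (F : nat -> set X) :
  (forall n, F n = set0 \/ A (F n)) -> (forall J, A J -> exists n, F n = J) ->
  \bigcup_(J in A) J = \bigcup_n F n.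
Proof.
move=> FA AF; apply/seteqP; split=> [x [J AJ Jx]|x [n _ Fnx]].
  by have [n FJ] := AF _ AJ; exists n => //; rewrite FJ.
have [F0|AFn] := FA n; first by rewrite F0 in Fnx.
by exists (F n).
Qed.

Lemma countable_bigcup_measurable d (X : measurableType d) (A : set (set X)) :
  countable A -> A `<=` measurable -> measurable (\bigcup_(J in A) J).
Proof.
move=> cA mA; have [F [FA AF _]] := countable_family_seq cA.
rewrite (bigcup_family_seq FA AF); apply: bigcupT_measurable => n.
by have [->|/mA] := FA n; first exact: measurable0.
Qed.

(** Two measures are allowed so that restricted and scaled copies of one measure can be compared
    cell by cell. *)
Lemma le_measure_bigcup d (X : measurableType d) (R : realType)
    (m1 m2 : {measure set X -> \bar R}) (A : set (set X)) :
  countable A -> A `<=` measurable -> trivIset A id ->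
  (forall J, A J -> (m1 J <= m2 J)%E) ->
  (m1 (\bigcup_(J in A) J) <= m2 (\bigcup_(J in A) J))%E.
Proof.
move=> cA mA tA m12; have [F [FA AF tF]] := countable_family_seq cA.
have mF n : measurable (F n) by have [->|/mA] := FA n; first exact: measurable0.
rewrite (bigcup_family_seq FA AF) !measure_bigcup //; try exact: tF.
apply: lee_nneseries => // n _.
by have [->|/m12//] := FA n; rewrite !measure0.
Qed.

Lemma eq_measure_bigcup d (X : measurableType d) (R : realType)
    (m1 m2 : {measure set X -> \bar R}) (A : set (set X)) :
  countable A -> A `<=` measurable -> trivIset A id ->
  (forall J, A J -> m1 J = m2 J) ->
  m1 (\bigcup_(J in A) J) = m2 (\bigcup_(J in A) J).
Proof.
move=> cA mA tA m12.
by apply/eqP; rewrite eq_le !le_measure_bigcup// => J AJ; rewrite m12.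
Qed.

(** Open half-lines are stable under intersection, generate the Borel sets and exhaust the line, so
    uniqueness of measures applies. Laws are identified through their tails in this way. *)
Lemma eq_finite_measure_ray (R : realType)
    (m1 m2 : {measure set (measurableTypeR R) -> \bar R}) :
  (forall s : R, (m1 `]s, +oo[%classic < +oo)%E) ->
  (forall s : R, m1 `]s, +oo[%classic = m2 `]s, +oo[%classic) ->
  forall B, measurable B -> m1 B = m2 B.
Proof.
move=> m1oo m12 B mB.
apply: (@measure_unique _ R (measurableTypeR R)
  [set A | exists s, A = `]s, +oo[%classic]
  (fun n => `]- n%:R, +oo[%classic) _ _ _ _ m1 m2) => //.
- exact: RGenOInfty.measurableE.
- move=> _ _ [s ->] [t ->]; exists (Num.max s t).
  by apply/seteqP; split=> x /=; rewrite !in_itv/= !andbT gt_max => /andP.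
- by move=> n; exists (- n%:R).
- apply/seteqP; split=> // x _; exists (Num.bound `|x|) => //=.
  rewrite in_itv/= andbT ltrNl (le_lt_trans (ler_norm _))// normrN.
  exact: archi_boundP.
- by move=> A [s ->]; exact: m12.
Qed.

Lemma mass1_fin_num_fun d (X : measurableType d) (R : realType)
    (mu : {measure set X -> \bar R}) :
  mu setT = 1%E -> fin_num_fun mu.
Proof.
move=> mu1 A mA; rewrite ge0_fin_numE// (@le_lt_trans _ _ 1%E) ?ltry//.
by rewrite -mu1; apply: le_measure; rewrite ?inE.
Qed.

(** * Trees *)

(** The tree seen as a sequence of ever finer partitions whose mesh tends to zero; the children map
    is forgotten and only the levels remain. *)
Record tree_filtration d (X : measurableType d) (R : realType)
    (mu : {measure set X -> \bar R}) (T : set (set X))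
    (L : nat -> set (set X)) : Prop := TreeFiltration {
  tree_levelE : T = \bigcup_n L n;
  tree_measurable : T `<=` measurable;
  tree_gt0 : forall J, T J -> (0 < mu J)%E;
  tree_countable : countable T;
  tree_root : L 0%N = [set setT];
  tree_cover : forall n x, exists2 J, L n J & J x;
  tree_disjoint : forall n J J' x, L n J -> L n J' -> J x -> J' x -> J = J';
  tree_refine : forall m n J, (m <= n)%N -> L n J -> exists2 J', L m J' & J `<=` J';
  tree_small : forall e : R, 0 < e ->
    exists n, forall J, L n J -> (mu J < e%:E)%E }.

Lemma is_tree_filtration d (X : measurableType d) (R : realType)
    (mu : {measure set X -> \bar R}) (T : set (set X)) :
  is_tree mu T -> exists L, tree_filtration mu T L.
Proof.
move=> [mT _ T0 [C [TC TE Tlim]]].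
pose L := tree_level C; have LT n : L n `<=` T by rewrite TE => J LJ; exists n.
have CT n J : L n J -> [/\ C J `<=` T, countable (C J),
    exists A B, [/\ C J A, C J B & A <> B], trivIset (C J) id &
    J = \bigcup_(A in C J) A] by move=> /LT; exact: TC.
have cL n : countable (L n).
  elim: n => [|n ih]; first exact: countable1.
  by apply: bigcup_countable => // J /CT[].
exists L; split=> //.
- by rewrite TE; apply: bigcup_countable.
- move=> n x; elim: n => [|n [J LJ Jx]]; first by exists setT.
  have [_ _ _ _ JE] := CT _ _ LJ; move: Jx; rewrite JE => -[A CA Ax].
  by exists A => //; exists J.
- move=> n; elim: n => [|n ih] J J' x; first by move=> -> ->.
  move=> [I LI CIJ] [I' LI' CIJ'] Jx Jx'.
  have [_ _ _ tI IE] := CT _ _ LI; have [_ _ _ _ IE'] := CT _ _ LI'.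
  have II' : I = I'.
    by apply: (ih _ _ x) => //; [rewrite IE; exists J|rewrite IE'; exists J'].
  by apply: tI => //; [rewrite II'|exists x].
- move=> m n J /subnKC <-; elim: (n - m)%N J => [J|p ih J].
    by rewrite addn0 => LJ; exists J.
  rewrite addnS => -[I LI CIJ]; have [_ _ _ _ IE] := CT _ _ LI.
  have [J' LJ' IJ'] := ih _ LI; exists J' => //; apply: subset_trans IJ'.
  by move=> x Jx; rewrite IE; exists J.
- move=> e e0; have : nbhs 0%E (fun y : \bar R => (y < e%:E)%E).
    by apply: open_ereal_lt'; rewrite lte_fin.
  move=> /Tlim[n _ /(_ n (leqnn n)) /= supe]; exists n => J LJ.
  by apply: le_lt_trans supe; apply: ereal_sup_ubound; exists J.
Qed.

Section tree_filtration.
Context d (X : measurableType d) (R : realType).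
Context (mu : {measure set X -> \bar R}) (T : set (set X)).
Context (L : nat -> set (set X)) (TL : tree_filtration mu T L).

Lemma tree_level_sub n : L n `<=` T.
Proof. by rewrite (tree_levelE TL) => J LJ; exists n. Qed.

Lemma tree_nested m n I J x : (m <= n)%N -> L m I -> L n J -> I x -> J x ->
  J `<=` I.
Proof.
move=> mn LI LJ Ix Jx; have [J' LJ' JJ'] := tree_refine TL mn LJ.
by rewrite (tree_disjoint TL LI LJ' Ix (JJ' _ Jx)).
Qed.

(** One refinement step: at the level of [J], or in [I] itself if that is already finer, membership
    in [J] is constant on a cell. Iterating over finitely many [J] fixes finitely many digits of the
    code. *)
Lemma tree_separate I J x : T I -> T J -> I x ->
  exists J', [/\ T J', J' x, J' `<=` I & J' `<=` J \/ J' `&` J = set0].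
Proof.
rewrite (tree_levelE TL) => -[m _ LI] [n _ LJ] Ix.
have [nm|/ltnW mn] := leqP n m.
  exists I; split=> //; first by exists m.
  have [[y [Iy Jy]]|IJ0] := pselect (exists y, I y /\ J y).
    by left; exact: tree_nested nm LJ LI Jy Iy.
  by right; apply/seteqP; split=> // y [Iy Jy]; apply: IJ0; exists y.
have [J' LJ' J'x] := tree_cover TL n x; exists J'; split=> //.
- by exists n.
- exact: tree_nested mn LI LJ' Ix J'x.
- have [[y [J'y Jy]]|IJ0] := pselect (exists y, J' y /\ J y).
    by left; rewrite (tree_disjoint TL LJ LJ' Jy J'y).
  by right; apply/seteqP; split=> // y [Iy Jy]; apply: IJ0; exists y.
Qed.

Definition maximal_cells (A : set (set X)) : set (set X) :=
  [set J | A J /\ forall J', A J' -> J `<=` J' -> J' = J].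

Lemma maximal_cells_trivIset A : A `<=` T -> trivIset (maximal_cells A) id.
Proof.
move=> AT J J' [AJ mJ] [AJ' mJ'] [x [/= Jx J'x]].
have := AT _ AJ; have := AT _ AJ'.
rewrite (tree_levelE TL) => -[m _ LJ'] [n _ LJ].
have [mn|/ltnW nm] := leqP m n.
  by have /(mJ _ AJ')-> := tree_nested mn LJ' LJ J'x Jx.
by have /(mJ' _ AJ) := tree_nested nm LJ LJ' Jx J'x.
Qed.

(** Among the members of [A] through a given point, one of least level is maximal: cells with a
    common point are nested in the order of their levels. *)
Lemma bigcup_maximal_cells A : A `<=` T ->
  \bigcup_(J in maximal_cells A) J = \bigcup_(J in A) J.
Proof.
move=> AT; apply/seteqP; split=> x [J]; first by move=> [AJ _] Jx; exists J.
move=> AJ Jx.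
have AL : exists n, `[< exists J', [/\ A J', L n J' & J' x] >].
  have := AT _ AJ; rewrite (tree_levelE TL) => -[n _ LJ].
  by exists n; apply/asboolP; exists J.
have [n /asboolP[J' [AJ' LJ' J'x]] nmin] := ex_minnP AL.
exists J' => //; split=> // I AI J'I; apply/seteqP; split=> //.
have := AT _ AI; rewrite (tree_levelE TL) => -[m _ LI].
apply: (tree_nested _ LJ' LI J'x (J'I _ J'x)).
by apply: nmin; apply/asboolP; exists I; split => //; exact: J'I.
Qed.

Lemma subset_tree_countable A : A `<=` T -> countable A.
Proof. by move=> AT; apply: sub_countable (tree_countable TL); exact: subset_card_le. Qed.

Lemma tree_bigcup_measurable A : A `<=` T -> measurable (\bigcup_(J in A) J).
Proof.
move=> AT; apply: countable_bigcup_measurable; first exact: subset_tree_countable.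
by apply: subset_trans AT (tree_measurable TL).
Qed.

End tree_filtration.

(** * An injective code for the points of a tree *)

Section ternary_code.
Context d (X : measurableType d) (R : realType) (D : nat -> set X).

(* Base 3 rather than 2, so that all later digits cannot make up for one that
   differs. *)
Definition ternary_sum (x : X) (N : nat) : R :=
  \sum_(n < N) 3^-1 ^+ n * \1_(D n) x.

(** The limit of the increasing partial sums, written with [sups] so that measurability follows from
    [measurable_fun_sups]. *)
Definition ternary_code (x : X) : R := sups (ternary_sum x) 0.

Lemma ternary_sum_le x N M : (N <= M)%N -> ternary_sum x N <= ternary_sum x M.
Proof.
move=> /subnKC <-; elim: (M - N)%N => [|m ih]; first by rewrite addn0.
rewrite addnS; apply: le_trans ih _; rewrite /ternary_sum big_ord_recr/= lerDl.
by rewrite mulr_ge0// exprn_ge0// invr_ge0.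
Qed.

(** The quantity [ternary_sum x N + 2 * 3^-1 ^+ N] is nonincreasing in [N]: a new digit adds at most
    3^-N while the slack drops by (4/3) 3^-N. The constant 2 is cruder than the true 3/2, but still
    leaves a tail of (2/3) 3^-n after digit n. *)
Lemma ternary_sum_tail x N M :
  ternary_sum x M <= ternary_sum x N + 2 * 3^-1 ^+ N.
Proof.
have [MN|/ltnW /subnKC <-] := leqP M N.
  apply: le_trans (ternary_sum_le x MN) _.
  by rewrite lerDl mulr_ge0// exprn_ge0// invr_ge0.
suff : forall m, ternary_sum x (N + m) + 2 * 3^-1 ^+ (N + m) <=
    ternary_sum x N + 2 * 3^-1 ^+ N.
  move=> /(_ (M - N)%N); apply: le_trans.
  by rewrite lerDl mulr_ge0// exprn_ge0// invr_ge0.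
elim=> [|m ih]; first by rewrite addn0.
rewrite addnS; apply: le_trans ih; rewrite /ternary_sum big_ord_recr/= exprS.
have : 0 <= (3^-1 ^+ (N + m) : R) by rewrite exprn_ge0// invr_ge0.
have : \1_(D (N + m)) x <= 1 :> R by rewrite indicE; case: (_ \in _).
nra.
Qed.

Lemma ternary_sum_has_ubound x : has_ubound (range (ternary_sum x)).
Proof.
by exists (ternary_sum x 0 + 2 * 3^-1 ^+ 0) => _ [N _ <-]; exact: ternary_sum_tail.
Qed.

Lemma ternary_code_ge x N : ternary_sum x N <= ternary_code x.
Proof.
apply: ub_le_sup; last by exists N.
by have [b bP] := ternary_sum_has_ubound x; exists b => _ [n _ <-]; apply: bP; exists n.
Qed.

Lemma ternary_code_le x N : ternary_code x <= ternary_sum x N + 2 * 3^-1 ^+ N.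
Proof.
apply: ge_sup; first by exists (ternary_sum x 0); exists 0%N.
by move=> _ [M _ <-]; exact: ternary_sum_tail.
Qed.

Lemma ternary_code_ge0 x : 0 <= ternary_code x.
Proof. by apply: le_trans (ternary_code_ge x 0); rewrite /ternary_sum big_ord0. Qed.

Lemma ternary_code_le2 x : ternary_code x <= 2.
Proof.
by apply: le_trans (ternary_code_le x 0) _; rewrite /ternary_sum big_ord0 add0r expr0 mulr1.
Qed.

Lemma measurable_ternary_code : (forall n, measurable (D n)) ->
  measurable_fun setT ternary_code.
Proof.
move=> mD; apply: (measurable_fun_sups (h := fun N x => ternary_sum x N)).
  by move=> x _; exact: ternary_sum_has_ubound.
move=> N; apply: measurable_sum => n.
by apply: measurable_funM => //; exact: measurable_indic.
Qed.

Lemma eq_ternary_sum x y N : (forall n, (n < N)%N -> D n x <-> D n y) ->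
  ternary_sum x N = ternary_sum y N.
Proof.
move=> xy; apply: eq_bigr => n _; congr (_ * _); rewrite !indicE; congr (_%:R).
by congr (nat_of_bool _); apply/idP/idP; rewrite !inE => /xy; apply.
Qed.

(** At the first index n where memberships differ the sums differ by 3^-n, and the later digits
    recover at most (2/3) 3^-n. *)
Lemma ternary_code_inj x y : ternary_code x = ternary_code y ->
  forall n, D n x <-> D n y.
Proof.
move=> exy n; elim/ltn_ind: n => n ih.
suff main u v : ternary_code u = ternary_code v ->
    (forall m, (m < n)%N -> D m u <-> D m v) -> D n u -> D n v.
  split; apply: main => // m mn; have := ih _ mn; tauto.
move=> {exy} euv uv Du; apply: contrapT => nDv.
have : ternary_sum u n.+1 <= ternary_sum v n.+1 + 2 * 3^-1 ^+ n.+1.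
  by apply: le_trans (ternary_code_le _ _); rewrite -euv ternary_code_ge.
rewrite /ternary_sum !big_ord_recr/= -!/(ternary_sum _ _) (eq_ternary_sum uv).
rewrite !indicE mem_set// memNset// exprS.
have : 0 < (3^-1 ^+ n : R) by rewrite exprn_gt0// invr_gt0.
rewrite mulr1 mulr0 => *; lra.
Qed.

Lemma ternary_code_close x y N : (forall n, (n < N)%N -> D n x <-> D n y) ->
  ternary_code y <= ternary_code x + 2 * 3^-1 ^+ N.
Proof.
move=> xy; apply: le_trans (ternary_code_le y N) _.
by rewrite -(eq_ternary_sum xy) lerD2r ternary_code_ge.
Qed.

End ternary_code.

(* By the last clause every sublevel set [e < t] is a union of cells, so cutting a
   cell at a quantile of [e] yields subcells of any prescribed total measure. *)
Lemma exists_tree_code d (X : measurableType d) (R : realType)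
    (mu : {measure set X -> \bar R}) (T : set (set X)) L :
  tree_filtration mu T L ->
  exists e : X -> R, [/\ measurable_fun setT e,
    forall x, 0 <= e x <= 2,
    forall t, mu (e @^-1` [set t]) = 0%E &
    forall I x t, T I -> I x -> e x < t ->
      exists J, [/\ T J, J x & J `<=` I `&` [set y | e y < t]]].
Proof.
move=> TL; have [D [DT TD _]] := countable_family_seq (tree_countable TL).
have mD n : measurable (D n).
  by have [->|/(tree_measurable TL)] := DT n; first exact: measurable0.
have me := @measurable_ternary_code _ _ R _ mD.
exists (ternary_code R D); split=> //.
- by move=> x; rewrite ternary_code_ge0 ternary_code_le2.
(* Points with equal codes belong to the same cells, so a level set lies inside a single cell of
   each level, and these cells have arbitrarily small measure. *)
- move=> t; set A := _ @^-1` _.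
  have mA : measurable A by rewrite -[A]setTI; apply: me.
  apply/eqP; rewrite eq_le measure_ge0 andbT.
  apply/lee_addgt0Pr => _/posnumP[r]; rewrite add0e.
  have [A0|/set0P[x Ax]] := eqVneq A set0; first by rewrite A0 measure0 lee_fin.
  have r0 : 0 < r%:num by [].
  have [n Ln] := tree_small TL r0; have [J LJ Jx] := tree_cover TL n x.
  apply: le_trans (ltW (Ln _ LJ)); apply: le_measure; rewrite ?inE//.
    by apply: (tree_measurable TL); exact: (tree_level_sub TL LJ).
  have [m mJ] := TD _ (tree_level_sub TL LJ).
  move=> y Ay; rewrite -mJ; have : ternary_code R D x = ternary_code R D y.
    by rewrite Ax Ay.
  by move=> xy; apply/(ternary_code_inj xy m); rewrite mJ.
- move=> I x t TI Ix ext.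
  have [N tN] : exists N, ternary_code R D x + 2 * 3^-1 ^+ N < t.
    have [N _ /(_ N (leqnn N)) /=] : \forall N \near \oo,
        2 * 3^-1 ^+ N < t - ternary_code R D x.
      have c0 : (fun N => 2 * 3^-1 ^+ N : R) @ \oo --> (2 * 0 : R).
        apply: cvgMr; apply: cvg_expr.
        by rewrite ger0_norm ?invr_ge0// invf_lt1// ltr1n.
      by apply: (cvgr_lt (2 * 0 : R)) => //; rewrite mulr0 subr_gt0.
    by move=> ?; exists N; lra.
  (* It is enough to find a cell through x on which the first [N] digits are constant: there the
     code exceeds that of x by at most [2 * 3^-1 ^+ N], which stays below t. *)
  suff [J [TJ Jx JI JD]] : exists J, [/\ T J, J x, J `<=` I &
      forall n, (n < N)%N -> J `<=` D n \/ J `&` D n = set0].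
    exists J; split=> // y Jy; split; first exact: JI.
    apply: le_lt_trans tN; apply: ternary_code_close => n /JD[JDn|JDn0].
      by split=> _; exact: JDn.
    by split=> Dn; [have : (J `&` D n) x by split|have : (J `&` D n) y by split];
      rewrite JDn0.
  elim: N {tN} => [|N [J [TJ Jx JI JD]]]; first by exists I; split.
  have [D0|TDN] := DT N.
    exists J; split=> // n; rewrite ltnS leq_eqVlt => /predU1P[->|]; last exact: JD.
    by right; rewrite D0 setI0.
  have [J' [TJ' J'x J'J J'D]] := tree_separate TL TJ TDN Jx.
  exists J'; split=> //; first exact: (subset_trans J'J JI).
  move=> n; rewrite ltnS leq_eqVlt => /predU1P[->//|/JD[JDn|JDn0]].
    by left; exact: subset_trans JDn.
  by right; apply/seteqP; split=> // y [/J'J Jy Dy]; rewrite -JDn0.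
Qed.

(** * Quantiles of a function with null level sets *)

Lemma measurable_sublevel d (X : measurableType d) (R : realType) (e : X -> R) :
  measurable_fun setT e -> forall t, measurable [set x | e x <= t].
Proof.
move=> me t; rewrite (_ : [set _ | _] = e @^-1` `]-oo, t]); last first.
  by apply/seteqP; split=> x /=; rewrite in_itv.
by rewrite -[_ @^-1` _]setTI; apply: me => //; exact: measurable_itv.
Qed.

Section quantile.
Context d (X : measurableType d) (R : realType).
Context (mu : {measure set X -> \bar R}) (mu_fin : fin_num_fun mu).
Context (e : X -> R) (me : measurable_fun setT e) (e02 : forall x, 0 <= e x <= 2).
Context (e_null : forall t, mu (e @^-1` [set t]) = 0%E).

Let measurable_lt t : measurable [set x | e x < t].
Proof.
rewrite (_ : [set _ | _] = e @^-1` `]-oo, t[); last first.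
  by apply/seteqP; split=> x /=; rewrite in_itv.
by rewrite -[_ @^-1` _]setTI; apply: me => //; exact: measurable_itv.
Qed.

(** Null level sets make the distribution function of [e] on [A] continuous, so it attains s; the
    last point p where it is at most s gives the strict inequality beyond p. Continuity from below
    handles [e x < p], continuity from above [e x <= p]. Both forms are recorded: the strict set is
    a union of cells, the other is a value of the distribution function. *)
Lemma exists_quantile A (s : R) : measurable A -> 0 <= s -> (s%:E < mu A)%E ->
  exists p, [/\ mu (A `&` [set x | e x < p]) = s%:E,
    mu (A `&` [set x | e x <= p]) = s%:E &
    forall t, p < t -> (s%:E < mu (A `&` [set x | (e x <= t)%R]))%E].
Proof.
move=> mA s0 sA; pose F t := mu (A `&` [set x | e x <= t]).
have mAle t : measurable (A `&` [set x | e x <= t]).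
  by apply: measurableI => //; exact: measurable_sublevel.
have mAlt t : measurable (A `&` [set x | e x < t]) by exact: measurableI.
have F_nd t u : t <= u -> (F t <= F u)%E.
  move=> tu; apply: le_measure; rewrite ?inE//.
  by apply: setIS => x /= /le_trans; apply.
pose S := [set t | (F t <= s%:E)%E].
(* -1 lies below the range [0, 2] of [e], so the set is empty there; at 2 it is all of [A], whose
   measure exceeds s. *)
have S1 : S (-1).
  rewrite /S /= /F (_ : _ `&` _ = set0) ?measure0 ?lee_fin//.
  apply/seteqP; split=> // x [_ /=]; apply/negP; rewrite -ltNge.
  by have /andP[+ _] := e02 x; apply: lt_le_trans; rewrite oppr_lt0.
have S2 : ubound S 2.
  move=> t; rewrite leNgt; apply: contraPN => t2; apply/negP; rewrite -ltNge /F.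
  rewrite (_ : _ `&` _ = A)//; apply/setIidPl => x _ /=.
  by have /andP[_ /le_trans] := e02 x; apply; exact: ltW.
have hS : has_sup S by split; [exists (-1)|exists 2].
pose p := sup S; have pS t : p < t -> (s%:E < F t)%E.
  by move=> pt; rewrite ltNge; apply: contraTN pt => St; rewrite -leNgt ub_le_sup//; exists 2.
have Sp t : t < p -> (F t <= s%:E)%E.
  by move=> /(sup_gt (ex_intro _ _ S1))[u Su /ltW /F_nd]/le_trans; apply.
have lo : (mu (A `&` [set x | (e x < p)%R]) <= s%:E)%E.
  pose E n := A `&` [set x | e x <= p - n.+1%:R^-1].
  have EE : A `&` [set x | e x < p] = \bigcup_n E n.
    rewrite /E -setI_bigcupr; congr (_ `&` _); apply/seteqP; split=> x /=.
      move=> exp; have pe0 : 0 < (p - e x)^-1 by rewrite invr_gt0 subr_gt0.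
      exists (Num.bound (p - e x)^-1) => //=.
      rewrite lerBrDr -lerBrDl -[leRHS]invrK lef_pV2 ?posrE//.
      by rewrite (le_trans (ltW (archi_boundP (ltW pe0))))// ler_nat.
    by move=> [n _ /=] /le_lt_trans; apply; rewrite ltrBlDr ltrDl invr_gt0.
  have : mu \o E @ \oo --> mu (\bigcup_n E n).
    apply: nondecreasing_cvg_mu; [by move=> n; exact: mAle|by rewrite -EE|].
    apply/nondecreasing_seqP => n; apply/subsetPset; apply: setIS => x /= /le_trans.
    by apply; rewrite lerD2l lerN2 lef_pV2 ?posrE// ler_nat.
  move=> /(cvge_to_le (b := s%:E)); rewrite EE; apply; apply: nearW => n /=.
  by apply: Sp; rewrite ltrBlDr ltrDl invr_gt0.
have hi : (s%:E <= mu (A `&` [set x | (e x <= p)%R]))%E.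
  pose E n := A `&` [set x | e x <= p + n.+1%:R^-1].
  have EE : A `&` [set x | e x <= p] = \bigcap_n E n.
    apply/seteqP; split=> x /=.
      move=> [Ax exp] n _; split => //=; apply: le_trans exp _.
      by rewrite lerDl invr_ge0.
    move=> Ex; split; first by have [] := Ex 0%N Logic.I.
    rewrite leNgt; apply/negP => pex.
    have pe0 : 0 < (e x - p)^-1 by rewrite invr_gt0 subr_gt0.
    have [_ /=] := Ex (Num.bound (e x - p)^-1) Logic.I; apply/negP; rewrite -ltNge.
    rewrite -ltrBrDl -[ltRHS]invrK ltf_pV2 ?posrE//.
    by rewrite (lt_le_trans (archi_boundP (ltW pe0)))// ler_nat.
  have : mu \o E @ \oo --> mu (\bigcap_n E n).
    apply: nonincreasing_cvg_mu.
    - by rewrite -ge0_fin_numE// mu_fin//; exact: mAle.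
    - by move=> n; exact: mAle.
    - by rewrite -EE.
    - apply/nonincreasing_seqP => n; apply/subsetPset; apply: setIS => x /= /le_trans.
      by apply; rewrite lerD2l lef_pV2 ?posrE// ler_nat.
  move=> /(cvge_to_ge (b := s%:E)); rewrite EE; apply; apply: nearW => n /=.
  by apply/ltW/pS; rewrite ltrDl invr_gt0.
have lohi : (mu (A `&` [set x | (e x <= p)%R]) <= mu (A `&` [set x | (e x < p)%R]))%E.
  rewrite -[leRHS]adde0 -(e_null p).
  apply: le_trans (measureU2 _ _ _) => //; last first.
    by rewrite -[_ @^-1` _]setTI; apply: me.
  apply: le_measure; rewrite ?inE//.
    by apply: measurableU => //; rewrite -[_ @^-1` _]setTI; apply: me.
  move=> x [Ax /=]; rewrite le_eqVlt => /predU1P[->|exp]; [by right|by left].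
exists p; split=> //; apply/eqP; rewrite eq_le ?lo ?hi ?andbT.
- by rewrite (le_trans hi lohi).
- by rewrite (le_trans lohi lo).
Qed.

End quantile.

(** * Uniform variables adapted to a tree *)

(* The measure structure of [pushforward] carries a proof of measurability that
   unification cannot infer. *)
Definition image_measure d (X : measurableType d) (R : realType)
    (mu : {measure set X -> \bar R}) (V : X -> measurableTypeR R)
    (mV : measurable_fun setT V) : {measure set (measurableTypeR R) -> \bar R} :=
  @measure_function_pushforward__canonical__measure_function_Measure
    _ _ _ _ _ mu V mV.

Lemma eq_pushforward_ray d (X : measurableType d) (R : realType)
    (mu : {measure set X -> \bar R}) (V : X -> measurableTypeR R)
    (m : {measure set (measurableTypeR R) -> \bar R}) :
  measurable_fun setT V ->
  (forall s : R, (mu (V @^-1` `]s, +oo[) < +oo)%E) ->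
  (forall s : R, mu (V @^-1` `]s, +oo[) = m `]s, +oo[%classic) ->
  forall B, measurable B -> mu (V @^-1` B) = m B.
Proof.
move=> mV muoo mum B mB.
exact: (eq_finite_measure_ray (m1 := image_measure mu mV)).
Qed.

(** The conditional law of [V] given [J], multiplied through by [mu J] so that no extended division
    occurs. *)
Definition uniform_on d (X : measurableType d) (R : realType)
    (mu : {measure set X -> \bar R}) (J : set X) (V : X -> measurableTypeR R)
    (b : R) :=
  forall B, measurable B ->
    mu (V @^-1` B `&` J) =
      ((b^-1)%:E * mu J * lebesgue_measure (B `&` `]0%R, b]%classic))%E.

(** The probability integral transform: the distribution function of [e] on [A], normalised by
    [mu A], is continuous because level sets of [e] are null, so composing it with [e] gives a
    uniform variable. *)
Lemma exists_uniform_on d (X : measurableType d) (R : realType)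
    (mu : {measure set X -> \bar R}) (e : X -> R) (A : set X) :
  fin_num_fun mu ->
  measurable_fun setT e -> (forall x, 0 <= e x <= 2) ->
  (forall t, mu (e @^-1` [set t]) = 0%E) ->
  measurable A -> (0 < mu A)%E ->
  exists2 V : X -> measurableTypeR R, measurable_fun setT V & uniform_on mu A V 1.
Proof.
move=> mu_fin me e02 e0 mA A0.
pose F t := fine (mu (A `&` [set x | e x <= t])).
have mle t : measurable (A `&` [set x | e x <= t]).
  by apply: measurableI => //; exact: measurable_sublevel.
have fF t : (mu (A `&` [set x | (e x <= t)%R]) = (F t)%:E)%E.
  by rewrite fineK// mu_fin.
have fA : mu A = (fine (mu A))%:E by rewrite fineK// mu_fin.
have a0 : 0 < fine (mu A) by rewrite -lte_fin -fA.
have F_nd : nondecreasing_fun F.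
  move=> t u tu; rewrite -lee_fin -!fF; apply: le_measure; rewrite ?inE//.
  by apply: setIS => x /= /le_trans; apply.
have F0 t : 0 <= F t by rewrite fine_ge0.
have F1 t : F t <= fine (mu A).
  by rewrite -lee_fin -fA -fF; apply: le_measure; rewrite ?inE//; exact: subIsetl.
pose V x := F (e x) / fine (mu A).
have mV : measurable_fun setT V.
  apply: measurable_funM => //.
  by apply: (measurableT_comp (f := F)) => //; exact: nondecreasing_measurable.
exists V => // B mB.
rewrite invr1 mul1e fA.
have a0' : 0 <= fine (mu A) := ltW a0.
have := @eq_pushforward_ray _ _ _ (mrestr mu mA) V
  (mscale (NngNum a0') (mrestr (@lebesgue_measure R) (measurable_itv `]0, 1]))).
apply=> //.
  move=> s; rewrite /mrestr/= -ge0_fin_numE// mu_fin//.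
  by apply: measurableI => //; rewrite -[X in measurable X]setTI; apply: mV.
move=> {B mB} s; change (mu (V @^-1` `]s, +oo[ `&` A) =
  (fine (mu A))%:E * lebesgue_measure (`]s, +oo[ `&` `]0%R, 1%R]%classic))%E.
have VE : V @^-1` `]s, +oo[ = [set x | s * fine (mu A) < F (e x)].
  by apply/seteqP; split=> x /=; rewrite in_itv/= andbT ltr_pdivlMr.
rewrite VE; have [s0|s0] := ltP s 0.
  rewrite (_ : _ `&` A = A); last first.
    by apply/setIidPr => x _ /=; apply: lt_le_trans (F0 _); rewrite nmulr_rlt0.
  rewrite (_ : _ `&` _ = `]0, 1]%classic); last first.
    apply/setIidPr => x /=; rewrite !in_itv/= andbT => /andP[x0 _].
    exact: lt_trans x0.
  by rewrite lebesgue_measure_itv/= lte_fin ltr01 oppr0 adde0 mule1.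
have [s1|s1] := leP 1 s.
  rewrite (_ : _ `&` A = set0); last first.
    apply/seteqP; split=> // x [/= + _]; apply/negP; rewrite -leNgt.
    by rewrite (le_trans (F1 _))// ler_peMl.
  rewrite (_ : _ `&` _ = set0) ?measure0 ?mule0//.
  apply/seteqP; split=> // x []; rewrite /= !in_itv/= andbT => sx /andP[_].
  by apply/negP; rewrite -ltNge (le_lt_trans s1).
have sA0 : 0 <= s * fine (mu A) by rewrite mulr_ge0.
have sA : ((s * fine (mu A))%:E < mu A)%E by rewrite fA lte_fin gtr_pMl.
have [p [_ pE pS]] := exists_quantile mu_fin me e02 e0 mA sA0 sA.
(* With p the quantile at level s [mu A], the event that [V] exceeds s is exactly the part of [A]
   where [e] exceeds p; the strict clause of [exists_quantile] excludes a flat stretch after p. *)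
rewrite (_ : _ `&` A = A `\` (A `&` [set x | e x <= p])); last first.
  rewrite setIC setDIr setDv set0U; apply/seteqP; split=> x /= [Ax].
    move=> Fs; split => //=; apply/negP; rewrite -ltNge ltNge; apply: contraTN Fs.
    by move=> /F_nd; rewrite -leNgt {2}/F pE.
  move=> /negP; rewrite -ltNge => /pS; rewrite fF lte_fin; split => //.
have -> : mu (A `\` (A `&` [set x | e x <= p])) =
    ((fine (mu A))%:E - (s * fine (mu A))%:E)%E.
  rewrite measureD//; last by rewrite -ge0_fin_numE ?mu_fin.
  by rewrite -fA -pE setIA setIid.
rewrite (_ : `]s, +oo[ `&` `]0, 1] = `]s, 1]%classic); last first.
  apply/seteqP; split=> x /=; rewrite !in_itv/= andbT.
    by move=> [-> /andP[_ ->]].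
  by move=> /andP[sx ->]; rewrite sx (le_lt_trans s0).
by rewrite lebesgue_measure_itv/= lte_fin s1 fA -!EFinB -EFinM; congr EFin; ring.
Qed.

(** As functions of [B] both sides are measures, and they agree on half-open intervals. *)
Lemma lebesgue_measure_affine (R : realType) (c u : R) (B : set (measurableTypeR R)) :
  0 < c -> measurable B ->
  (c%:E * lebesgue_measure ((fun x : R => (u + c * x)%R) @^-1` B) = lebesgue_measure B)%E.
Proof.
move=> c0 mB; have mf : measurable_fun [set: measurableTypeR R]
    (fun x : measurableTypeR R => u + c * x : measurableTypeR R).
  by apply: measurable_funD => //; apply: measurable_funM.
have c0' : 0 <= c := ltW c0.
apply/esym; have := @lebesgue_measure_unique R
  (mscale (NngNum c0') (pushforward (@lebesgue_measure R)
     (fun x : measurableTypeR R => u + c * x : measurableTypeR R))).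
apply => //.
move=> _ [[a b] _ <-]; change (lebesgue_measure `]a, b]%classic =
  c%:E * lebesgue_measure ((fun x : R => (u + c * x)%R) @^-1` `]a, b]))%E.
rewrite (_ : _ @^-1` _ = `](a - u) / c, (b - u) / c]%classic); last first.
  apply/seteqP; split=> x /=.
    by rewrite !in_itv/= ltr_pdivrMr// ler_pdivlMr// (mulrC x) ltrBlDl lerBrDl.
  by rewrite !in_itv/= ltr_pdivrMr// ler_pdivlMr// (mulrC x) ltrBlDl lerBrDl.
rewrite !lebesgue_measure_itv/= !lte_fin ltr_pM2r ?invr_gt0// ltrD2r.
case: ifPn => _; last by rewrite mule0.
by rewrite -!EFinB -EFinM; congr EFin; field; rewrite gt_eqF.
Qed.

Lemma eq_uniform_on d (X : measurableType d) (R : realType)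
    (mu : {measure set X -> \bar R}) (J : set X) (V W : X -> measurableTypeR R) b :
  (forall x, J x -> V x = W x) -> uniform_on mu J V b -> uniform_on mu J W b.
Proof.
move=> VW uV B mB; rewrite -uV//; congr (mu _).
by apply/seteqP; split=> x /= [+ Jx]; rewrite VW.
Qed.

(** Serves both pieces of the recursive construction: u = 0 and c = a on the chosen subcells, u = a
    and c = 1 - a on the remainder. *)
Lemma uniform_on_affine d (X : measurableType d) (R : realType)
    (mu : {measure set X -> \bar R}) (J : set X) (V : X -> measurableTypeR R)
    (b c u : R) (B : set (measurableTypeR R)) :
  0 < b -> 0 < c -> uniform_on mu J V b -> measurable B ->
  mu ((fun x => u + c * V x) @^-1` B `&` J) =
  (((c * b)^-1)%:E * mu J * lebesgue_measure (B `&` `]u, (u + c * b)%R]%classic))%E.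
Proof.
move=> b0 c0 uV mB.
have mf : measurable_fun [set: measurableTypeR R]
    (fun x : measurableTypeR R => u + c * x : measurableTypeR R).
  by apply: measurable_funD => //; apply: measurable_funM.
have mB' : measurable ((fun x : measurableTypeR R => u + c * x) @^-1` B).
  by rewrite -[_ @^-1` _]setTI; apply: mf.
rewrite -[X in mu X]/(V @^-1` ((fun x => u + c * x) @^-1` B) `&` J) uV//.
rewrite -(@lebesgue_measure_affine _ c u (B `&` _) c0); last first.
  by apply: measurableI => //; exact: measurable_itv.
rewrite muleCA !muleA -EFinM; congr (_%:E * _ * lebesgue_measure _)%E.
  by field; rewrite !gt_eqF.
rewrite preimage_setI; congr (_ `&` _); apply/seteqP; split=> x /=.
  by rewrite !in_itv/= ltrDl lerD2l ler_pM2l// pmulr_rgt0.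
by rewrite !in_itv/= ltrDl lerD2l ler_pM2l// pmulr_rgt0.
Qed.

Lemma measurable_glue d d' (X : measurableType d) (Y : measurableType d')
    (M : set (set X)) (V : set X -> X -> Y) (W U : X -> Y) :
  countable M -> M `<=` measurable ->
  (forall J, M J -> measurable_fun setT (V J)) -> measurable_fun setT W ->
  (forall J x, M J -> J x -> U x = V J x) ->
  (forall x, ~ (\bigcup_(J in M) J) x -> U x = W x) ->
  measurable_fun setT U.
Proof.
move=> cM mM mV mW UV UW _ B mB; rewrite setTI.
have mVB J : M J -> measurable (V J @^-1` B).
  by move=> MJ; rewrite -[_ @^-1` _]setTI; apply: mV.
have mWB : measurable (W @^-1` B) by rewrite -[_ @^-1` _]setTI; apply: mW.
rewrite (_ : _ @^-1` _ =
    (\bigcup_(A in [set J `&` V J @^-1` B | J in M]) A) `|`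
    (~` (\bigcup_(J in M) J) `&` W @^-1` B)).
  apply: measurableU.
    apply: countable_bigcup_measurable.
      by apply: sub_countable cM; exact: card_image_le.
    by move=> _ [J MJ <-]; apply: measurableI; [exact: mM|exact: mVB].
  by apply: measurableI => //; apply: measurableC; exact: countable_bigcup_measurable.
rewrite bigcup_image; apply/seteqP; split=> x /=.
  have [[J MJ Jx]|nMx] := pselect ((\bigcup_(J in M) J) x).
    by rewrite (UV _ _ MJ Jx) => Bx; left; exists J.
  by rewrite (UW _ nMx) => Bx; right.
by move=> [[J MJ [Jx]]|[nMx]]; [rewrite (UV _ _ MJ Jx)|rewrite (UW _ nMx)].
Qed.

Lemma lebesgue_measure_itv_fin (R : realType) (u v : R) (B : set (measurableTypeR R)) :
  measurable B ->
  exists2 l : R, 0 <= l & lebesgue_measure (B `&` `]u, v]%classic) = l%:E.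
Proof.
move=> mB; have muv : measurable (B `&` `]u, v]%classic).
  by apply: measurableI => //; exact: measurable_itv.
exists (fine (lebesgue_measure (B `&` `]u, v]%classic))); first by rewrite fine_ge0.
rewrite fineK// ge0_fin_numE//.
apply: (@le_lt_trans _ _ (lebesgue_measure `]u, v]%classic)).
  by apply: le_measure; rewrite ?inE//; exact: subIsetr.
by rewrite lebesgue_measure_itv/=; case: ifP => _; rewrite ?ltry// -EFinB ltry.
Qed.

Section uniform_cells.
Context d (X : measurableType d) (R : realType).
Context (mu : {measure set X -> \bar R}) (mu_fin : fin_num_fun mu).
Context (T : set (set X)) (L : nat -> set (set X)) (TL : tree_filtration mu T L).
Context (a : R) (a01 : 0 < a < 1).

(** All cells with the property are collected, overlapping or not, because the maximal function only
    sees their union. *)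
Definition uniform_cells (I : set X) (V : X -> measurableTypeR R) (b : R) :=
  [set J | [/\ T J, J `<=` I & uniform_on mu J V b]].

(** Cut [I] at the quantile of the code of level a [mu I]: the part below is a union of cells, and
    passing to the maximal ones makes them disjoint. *)
Lemma exists_tree_split I : T I -> exists M : set (set X),
  [/\ M `<=` T, trivIset M id, \bigcup_(J in M) J `<=` I &
      mu (\bigcup_(J in M) J) = (a%:E * mu I)%E].
Proof.
move=> TI; have [e [me e02 e0 eT]] := exists_tree_code TL.
have [a0 a1] := andP a01; have mI := tree_measurable TL TI.
have fI : mu I = (fine (mu I))%:E by rewrite fineK// mu_fin.
have i0 : 0 < fine (mu I) by rewrite -lte_fin -fI; exact: (tree_gt0 TL).
have s0 : 0 <= a * fine (mu I) by rewrite mulr_ge0// ltW.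
have sI : ((a * fine (mu I))%:E < mu I)%E by rewrite fI lte_fin gtr_pMl.
have [p [pE _ _]] := exists_quantile mu_fin me e02 e0 mI s0 sI.
pose A := [set J | T J /\ J `<=` I `&` [set x | e x < p]].
have AT : A `<=` T by move=> J [].
have AE : \bigcup_(J in A) J = I `&` [set x | e x < p].
  apply/seteqP; split=> x; first by move=> [J [_ +]] => /[apply].
  by move=> [Ix ex]; have [J [TJ Jx JI]] := eT _ _ _ TI Ix ex; exists J.
exists (maximal_cells A); split.
- by move=> J [/AT].
- exact: (maximal_cells_trivIset TL).
- by rewrite (bigcup_maximal_cells TL)// AE; exact: subIsetl.
- by rewrite (bigcup_maximal_cells TL)// AE pE fI EFinM.
Qed.

Lemma exists_uniform_cells N I : T I ->
  exists V : X -> measurableTypeR R,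
    [/\ measurable_fun setT V, uniform_on mu I V 1 &
        forall m, (m <= N)%N ->
          ((a ^+ m)%:E * mu I <= mu (\bigcup_(J in uniform_cells I V (a ^+ m)) J))%E].
Proof.
have [e [me e02 e0 _]] := exists_tree_code TL.
have [a0 a1] := andP a01.
have mT J : T J -> measurable J by exact: (tree_measurable TL).
have mcells K V b : measurable (\bigcup_(J in uniform_cells K V b) J).
  by apply: (tree_bigcup_measurable TL) => J [].
have cells0 K V : T K -> uniform_on mu K V 1 ->
    ((a ^+ 0)%:E * mu K <= mu (\bigcup_(J in uniform_cells K V (a ^+ 0)) J))%E.
  move=> TK uV; rewrite expr0 mul1e; apply: le_measure; rewrite ?inE//; first exact: mT.
  by move=> x Kx; exists K => //; split.
elim: N I => [|N ih] I TI.
  have [V mV uV] := exists_uniform_on mu_fin me e02 e0 (mT _ TI) (tree_gt0 TL TI).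
  by exists V; split=> // m; rewrite leqn0 => /eqP ->; exact: cells0.
have [M [MT tM MI muM]] := exists_tree_split TI.
have cM : countable M := subset_tree_countable TL MT.
have mM : M `<=` measurable by move=> J /MT/mT.
set U := \bigcup_(J in M) J in MI muM.
have mU : measurable U by exact: countable_bigcup_measurable.
have mI := mT _ TI.
have [i fI] : exists i, mu I = i%:E by exists (fine (mu I)); rewrite fineK// mu_fin.
have i0 : 0 < i by rewrite -lte_fin -fI; exact: (tree_gt0 TL).
have mR : measurable (I `\` U) by exact: measurableD.
have IU : I `&` U = U by apply/setIidPr.
have muR : mu (I `\` U) = ((1 - a) * i)%:E.
  transitivity (i%:E - mu U)%E; last first.
    by rewrite muM fI -EFinM -EFinB; congr EFin; ring.
  by rewrite measureD//; [rewrite IU -fI|rewrite -ge0_fin_numE ?mu_fin].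
have R0 : (0 < mu (I `\` U))%E by rewrite muR lte_fin mulr_gt0// subr_gt0.
have [W mW uW] := exists_uniform_on mu_fin me e02 e0 mR R0.
have /choice[VJ VJP] : forall J, exists V : X -> measurableTypeR R, M J ->
    [/\ measurable_fun setT V, uniform_on mu J V 1 & forall m, (m <= N)%N ->
      ((a ^+ m)%:E * mu J <= mu (\bigcup_(K in uniform_cells J V (a ^+ m)) K))%E].
  move=> J; have [MJ|nMJ] := pselect (M J); last by exists W.
  by have [V VP] := ih _ (MT _ MJ); exists V.
have /choice[cell cellP] : forall x, exists J, U x -> M J /\ J x.
  by move=> x; have [[J MJ Jx]|nUx] := pselect (U x); [exists J|exists set0].
(* [U] has relative measure a, so values in (0, a] there and in (a, 1] elsewhere fit together into a
   uniform variable. The summand 0 matches the affine form of [uniform_on_affine]. *)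
pose V x : measurableTypeR R :=
  if `[< U x >] then 0 + a * VJ (cell x) x else a + (1 - a) * W x.
have VE J x : M J -> J x -> V x = 0 + a * VJ J x.
  move=> MJ Jx; have Ux : U x by exists J.
  rewrite /V asboolT//; have [Mc cx] := cellP _ Ux.
  by rewrite (tM _ _ Mc MJ)//; exists x.
have VE' x : ~ U x -> V x = a + (1 - a) * W x by move=> nUx; rewrite /V asboolF.
have mV : measurable_fun setT V.
  apply: (measurable_glue (V := fun J x => 0 + a * VJ J x : measurableTypeR R)
    (W := fun x => a + (1 - a) * W x : measurableTypeR R) cM mM) => //.
  - move=> J MJ; have [mVJ _ _] := VJP _ MJ.
    by apply: measurable_funD => //; apply: measurable_funM.
  - by apply: measurable_funD => //; apply: measurable_funM.
have uVJ J K b : M J -> K `<=` J -> 0 < b -> uniform_on mu K (VJ J) b ->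
    uniform_on mu K V (a * b).
  move=> MJ KJ b0 uVJ; apply: (eq_uniform_on (V := fun x => 0 + a * VJ J x)).
    by move=> x /KJ Jx; rewrite (VE J).
  by move=> B mB; rewrite (uniform_on_affine 0 b0 a0 uVJ mB) add0r.
(* On [U] the mass a [mu I] is spread over (0, a], on the rest the mass (1 - a) [mu I] over (a, 1]:
   the density is [mu I] on both intervals. *)
have uV : uniform_on mu I V 1.
  move=> B mB; have mVB : measurable (V @^-1` B).
    by rewrite -[_ @^-1` _]setTI; apply: mV.
  have [l l0 lE] := lebesgue_measure_itv_fin 0 a mB.
  have [r r0 rE] := lebesgue_measure_itv_fin a 1 mB.
  have lrE : lebesgue_measure (B `&` `]0, 1]%classic) = (l + r)%:E.
    rewrite EFinD -lE -rE (@itv_bndbnd_setU _ _ _ (BRight a)) ?bnd_simp ?ltW//.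
    rewrite setIUr measureU//; try by apply: measurableI => //; exact: measurable_itv.
    apply/seteqP; split=> // x [[_ /=]]; rewrite !in_itv/= => /andP[_ xa] [_].
    by move=> /= /andP[/(le_lt_trans xa)]; rewrite ltxx.
  have c0 : 0 <= a^-1 * l by rewrite mulr_ge0// invr_ge0 ltW.
  have HU : mu (V @^-1` B `&` U) = (l * i)%:E.
    transitivity ((a^-1 * l)%:E * mu U)%E; last first.
      by rewrite muM fI -!EFinM; congr EFin; field; rewrite gt_eqF.
    rewrite setIC; apply: (eq_measure_bigcup (m1 := mrestr mu mVB)
      (m2 := mscale (NngNum c0) mu) cM mM tM) => J MJ.
    change (mu (J `&` V @^-1` B) = (a^-1 * l)%:E * mu J)%E; rewrite setIC.
    have [_ uJ _] := VJP _ MJ.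
    have uJ1 := uVJ _ _ _ MJ (@subset_refl _ J) ltr01 uJ.
    rewrite (uJ1 _ mB) mulr1 muleAC [X in lebesgue_measure X]/= lE.
    by rewrite EFinM.
  have HR : mu (V @^-1` B `&` (I `\` U)) = (r * i)%:E.
    have a10 : 0 < 1 - a by rewrite subr_gt0.
    have := uniform_on_affine a ltr01 a10 uW mB.
    rewrite muR (_ : a + (1 - a) * 1 = 1) ?rE; last by ring.
    rewrite -!EFinM => HR.
    transitivity (((1 - a) * 1)^-1 * ((1 - a) * i) * r)%:E; last first.
      by congr EFin; field; rewrite gt_eqF.
    rewrite -HR; congr (mu _).
    by apply/seteqP; split=> x /= [+ [Ix nUx]]; rewrite VE'.
  have -> : V @^-1` B `&` I = (V @^-1` B `&` U) `|` (V @^-1` B `&` (I `\` U)).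
    by rewrite -setIUr; congr (_ `&` _); rewrite -{1}IU setUIDK.
  transitivity (mu (V @^-1` B `&` U) + mu (V @^-1` B `&` (I `\` U)))%E; last first.
    by rewrite HU HR invr1 mul1e fI lrE -EFinM -EFinD; congr EFin; ring.
  rewrite measureU//.
  - exact: measurableI.
  - exact: measurableI.
  - by apply/seteqP; split=> // x [[_ Ux] [_ [_ /(_ Ux)]]].
(* Scale 0 is the cell [I] itself. A cell of scale a^m for [VJ J] inside [J] is one of scale a^(m+1)
   for [V] inside [I], since [V] is a times [VJ J] there; summing over [J] in [M] loses the factor a
   carried by [U]. *)
exists V; split=> // -[|m] mN; first exact: cells0.
set E := \bigcup_(J in _) J.
have -> : ((a ^+ m.+1)%:E * mu I = (a ^+ m)%:E * mu U)%E.
  by rewrite muM muleA -EFinM -exprSr.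
have am0 : 0 <= a ^+ m by rewrite exprn_ge0// ltW.
have mE : measurable E by exact: mcells.
apply: (@le_trans _ _ (mu (U `&` E))); last first.
  by apply: le_measure; rewrite ?inE//; exact: measurableI.
apply: (le_measure_bigcup (m1 := mscale (NngNum am0) mu) (m2 := mrestr mu mE) cM mM tM).
move=> J MJ; have [_ _ /(_ _ mN)] := VJP _ MJ; move=> /le_trans; apply.
apply: le_measure; rewrite ?inE//; first by apply: measurableI => //; exact: mM.
move=> x [K [TK KJ uK] Kx]; split; first exact: KJ.
exists K => //; split=> //.
  by apply: subset_trans KJ _ => y Jy; apply: MI; exists J.
by rewrite exprS; apply: uVJ uK => //; rewrite exprn_gt0.
Qed.

End uniform_cells.

(** * Rearrangements *)

Lemma ge0_integral_mrestr d (X : measurableType d) (R : realType)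
    (m : {measure set X -> \bar R}) (D : set X) (mD : measurable D) (f : X -> \bar R) :
  measurable_fun setT f -> (forall x, (0 <= f x)%E) ->
  (\int[mrestr m mD]_x f x = \int[m]_(x in D) f x)%E.
Proof.
move=> mf f0; rewrite (@ge0_negligible_integral _ _ _ _ setT (~` D))//; last 2 first.
- exact: measurableC.
- by rewrite /= /mrestr setICl measure0.
rewrite setTD setCK; apply: eq_measure_integral => A mA AD.
by rewrite /= /mrestr; congr (m _); apply/setIidPl.
Qed.

(** Change of variables through a common law on the line. The constant c absorbs a difference of
    total mass: the ratio of [mu J] to b for a uniform cell, the factor a for a dilation. *)
Lemma ge0_integral_same_law d1 d2 (X : measurableType d1) (Y : measurableType d2)
    (R : realType) (m1 : {measure set X -> \bar R}) (m2 : {measure set Y -> \bar R})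
    (D1 : set X) (D2 : set Y) (V : X -> measurableTypeR R)
    (W : Y -> measurableTypeR R) (c : R) (f : measurableTypeR R -> \bar R) :
  measurable D1 -> measurable D2 -> measurable_fun setT V -> measurable_fun setT W ->
  0 <= c ->
  (forall B, measurable B ->
    m1 (V @^-1` B `&` D1) = (c%:E * m2 (W @^-1` B `&` D2))%E) ->
  measurable_fun setT f -> (forall x, (0 <= f x)%E) ->
  (\int[m1]_(x in D1) f (V x) = c%:E * \int[m2]_(y in D2) f (W y))%E.
Proof.
move=> mD1 mD2 mV mW c0 m12 mf f0.
have push d (Z : measurableType d) (m : {measure set Z -> \bar R}) (D : set Z)
    (mD : measurable D) (U : Z -> measurableTypeR R) (mU : measurable_fun setT U) :
    (\int[m]_(x in D) f (U x) = \int[pushforward (mrestr m mD) U]_x f x)%E.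
  rewrite (ge0_integral_pushforward mU)//.
  by rewrite preimage_setT ge0_integral_mrestr//; [exact: (measurableT_comp mf mU)|move=> x; exact: f0].
rewrite (push _ _ m1 _ mD1 _ mV) (push _ _ m2 _ mD2 _ mW).
rewrite -(@ge0_integral_mscale _ _ _ (image_measure (mrestr m2 mD2) mW) setT measurableT (NngNum c0))//.
by apply: eq_measure_integral => //= B mB _; rewrite /mscale/=; exact: m12.
Qed.

Lemma nonincreasing_in_measurable (R : realType) (a b : R) (f : R -> R) :
  {in `]a, b] &, nonincreasing_fun f} -> measurable_fun `]a, b]%classic f.
Proof.
move=> fni mD; apply: (measurability _ (RGenOInfty.measurableE R)) => //.
move=> _ [_ [s ->] <-]; apply: is_interval_measurable => x y /=.
rewrite !in_itv/= !andbT => -[/andP[ax xb] _] [/andP[ay yb] sy] z /andP[xz zy].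
have az : a < z by exact: lt_le_trans xz.
have zb : z <= b by exact: le_trans yb.
split; first by rewrite /= in_itv/= az.
rewrite /= in_itv/= andbT; apply: lt_le_trans sy _.
by apply: fni; rewrite // in_itv/= ?az ?ay.
Qed.

(** The substance is right continuity of the distribution function: if the set above level s has
    measure greater than t, so has the set above some u > s, and such a u is a lower bound for the
    infimum. *)
Lemma rearrangement_gt d (X : measurableType d) (R : realType)
    (mu : {measure set X -> \bar R}) (psi : X -> \bar R) (s t : R) :
  measurable_fun setT psi -> 0 <= s ->
  (s%:E < rearrangement mu psi t)%E <-> (t%:E < mu [set x | s%:E < `|psi x|]%E)%E.
Proof.
move=> mpsi s0; have mS r : measurable [set x | r%:E < `|psi x|]%E.
  rewrite -[X in measurable X]setTI; apply: emeasurable_fun_o_infty => //.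
  exact: measurableT_comp.
have S_ni r u : r <= u -> (mu [set x | u%:E < `|psi x|] <= mu [set x | r%:E < `|psi x|])%E.
  move=> ru; apply: le_measure; rewrite ?inE// => x /=; apply: le_lt_trans.
  by rewrite lee_fin.
split.
  move=> srho; rewrite ltNge; apply/negP => st.
  move: srho; apply/negP; rewrite -leNgt; apply: ereal_inf_lbound; exists s => //.
move=> tS.
suff [u su ut] : exists2 u, s < u & (t%:E < mu [set x | u%:E < `|psi x|])%E.
  apply: (@lt_le_trans _ _ u%:E); first by rewrite lte_fin.
  apply: le_ereal_inf_tmp => _ [r [r0 rt] <-]; rewrite lee_fin leNgt; apply/negP => ru.
  by have := le_lt_trans (le_trans (S_ni _ _ (ltW ru)) rt) ut; rewrite ltxx.
apply: contrapT => nu; move: tS; apply/negP; rewrite -leNgt.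
pose E n := [set x | (s + n.+1%:R^-1)%:E < `|psi x|]%E.
have EE : [set x | s%:E < `|psi x|]%E = \bigcup_n E n.
  apply/seteqP; split=> x /=; last first.
    by move=> [n _]; apply: lt_trans; rewrite lte_fin ltrDl invr_gt0.
  suff key y : (s%:E < y)%E -> exists n, ((s + n.+1%:R^-1)%:E < y)%E.
    by move=> /key[n ny]; exists n.
  case: y => [r|_|//]; last by exists 0%N; rewrite ltry.
  rewrite lte_fin => sr; have rs0 : 0 < (r - s)^-1 by rewrite invr_gt0 subr_gt0.
  exists (Num.bound (r - s)^-1); rewrite lte_fin -ltrBrDl.
  rewrite -[ltRHS]invrK ltf_pV2 ?posrE//.
  by rewrite (lt_le_trans (archi_boundP (ltW rs0)))// ler_nat.
rewrite EE; have : mu \o E @ \oo --> mu (\bigcup_n E n).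
  apply: nondecreasing_cvg_mu; [by move=> n; exact: mS|by rewrite -EE|].
  apply/nondecreasing_seqP => n; apply/subsetPset => x /=; apply: le_lt_trans.
  by rewrite lee_fin lerD2l lef_pV2 ?posrE// ler_nat.
move=> /(cvge_to_le (b := t%:E)); apply; apply: nearW => n /=.
rewrite leNgt; apply/negP => tE; apply: nu; exists (s + n.+1%:R^-1) => //.
by rewrite ltrDl invr_gt0.
Qed.

Lemma le_measureU_null d (X : measurableType d) (R : realType)
    (mu : {measure set X -> \bar R}) (A B N : set X) :
  measurable A -> measurable B -> measurable N -> mu N = 0%E ->
  A `<=` B `|` N -> (mu A <= mu B)%E.
Proof.
move=> mA mB mN N0 AB; rewrite -[leRHS]adde0 -N0.
apply: le_trans (measureU2 _ _ _) => //.
by apply: le_measure; rewrite ?inE//; exact: measurableU.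
Qed.

Section equidistribution.
Context d (X : measurableType d) (R : realType).
Context (mu : {measure set X -> \bar R}) (mu1 : mu setT = 1%E).
Context (g : R -> R) (g_ge0 : forall t, t \in `]0, 1] -> 0 <= g t).
Context (g_noninc : {in `]0, 1] &, nonincreasing_fun g}).

(** Extension by zero: it turns a function constrained only on (0, 1] into one that is nonnegative
    and measurable on the whole line. *)
Definition restrict01 : measurableTypeR R -> measurableTypeR R :=
  g \_ (`]0, 1]%classic : set R).

Lemma restrict01E t : t \in `]0, 1] -> restrict01 t = g t.
Proof. by move=> t01; rewrite /restrict01 patchE mem_set. Qed.

Lemma measurable_restrict01 : measurable_fun setT restrict01.
Proof.
apply/(measurable_restrictT (g : measurableTypeR R -> measurableTypeR R)).
  exact: measurable_itv.
exact: nonincreasing_in_measurable.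
Qed.

Lemma restrict01_ge0 t : 0 <= restrict01 t.
Proof.
rewrite /restrict01 patchE; case: ifPn => // t01; apply: g_ge0.
by rewrite inE in t01.
Qed.

(* The redundant [setT] and [1%:E] give the form expected by
   [ge0_integral_same_law]. *)
Definition equidistributed (phi : X -> measurableTypeR R) := forall B, measurable B ->
  mu (phi @^-1` B `&` setT) =
  (1%:E * lebesgue_measure (restrict01 @^-1` B `&` `]0%R, 1%R]%classic))%E.

Let mu_fin : fin_num_fun mu := mass1_fin_num_fun mu1.

(** For s >= 0, put m = mu(phi > s). By [rearrangement_gt], off the exceptional null set g(t) > s
    holds exactly when t < m, so the tails of [phi] and of [g] agree. *)
Lemma rearrangement_equidistributed (phi : X -> R) :
  measurable_fun setT phi -> (forall x, 0 <= phi x) ->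
  {ae lebesgue_measure, forall t : R, t \in `]0, 1] ->
     rearrangement mu (EFin \o phi) t = (g t)%:E} ->
  equidistributed phi.
Proof.
move=> mphi phi0 [N [mN N0 subN]] B mB; rewrite setIT mul1e.
have m01 := measurable_itv (`]0, 1] : interval R).
pose m2 := image_measure (mrestr (@lebesgue_measure R) m01) measurable_restrict01.
have mphiV B' : measurable B' -> measurable (phi @^-1` B').
  by move=> mB'; rewrite -[_ @^-1` _]setTI; apply: mphi.
apply: (@eq_pushforward_ray _ _ _ mu phi m2) => //.
  move=> s; rewrite -ge0_fin_numE// mu_fin//; apply: mphiV; exact: measurable_itv.
move=> s; change (mu (phi @^-1` `]s, +oo[) =
  lebesgue_measure (restrict01 @^-1` `]s, +oo[ `&` `]0%R, 1%R]%classic)).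
have [s0|s0] := ltP s 0.
  rewrite (_ : _ @^-1` _ = setT); last first.
    by apply/seteqP; split=> // x _; rewrite /= in_itv/= andbT (lt_le_trans s0).
  rewrite (_ : _ `&` _ = `]0, 1]%classic) ?mu1 ?lebesgue_measure_itv/= ?lte_fin ?ltr01.
    by rewrite oppr0 adde0.
  apply/setIidPr => x _; rewrite /= in_itv/= andbT (lt_le_trans s0)//.
  exact: restrict01_ge0.
have mS : measurable (phi @^-1` `]s, +oo[) by apply: mphiV; exact: measurable_itv.
have [m mE] : exists m, mu (phi @^-1` `]s, +oo[) = m%:E.
  by exists (fine (mu (phi @^-1` `]s, +oo[))); rewrite fineK// mu_fin.
have m0 : 0 <= m by rewrite -lee_fin -mE.
have m1 : m <= 1.
  by rewrite -lee_fin -mE -[leRHS]mu1; apply: le_measure; rewrite ?inE.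
(* The number m is replaced by the length of (0, m), so that two subsets of the line can be compared
   up to the null set [N]. *)
have -> : mu (phi @^-1` `]s, +oo[) = lebesgue_measure (`]0, m[%classic : set R).
  rewrite mE lebesgue_measure_itv/= lte_fin; case: ltgtP m0 => // [|<-//].
  by rewrite oppr0 adde0.
have key t : ~ N t -> t \in `]0, 1] -> (s < g t) = (t < m).
  move=> Nt t01; have gt : rearrangement mu (EFin \o phi) t = (g t)%:E.
    by apply: contrapT => ngt; apply: Nt; apply: subN => /(_ t01).
  have /(@rearrangement_gt _ _ _ mu _ s t)/(_ s0) : measurable_fun setT (EFin \o phi).
    exact/measurable_EFinP.
  rewrite gt lte_fin (_ : [set x | _] = phi @^-1` `]s, +oo[) ?mE ?lte_fin; last first.
    by apply/seteqP; split=> x /=; rewrite in_itv/= andbT lte_fin ger0_norm.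
  by move=> [h1 h2]; apply/idP/idP.
have mg : measurable (restrict01 @^-1` `]s, +oo[ `&` `]0%R, 1%R]%classic).
  apply: (measurableI _ _ _ m01); rewrite -[X in measurable X]setTI.
  exact: (measurable_restrict01 _ (measurable_itv (`]s, +oo[ : interval R))).
have m0m := measurable_itv (`]0, m[ : interval R).
apply/eqP; rewrite eq_le; apply/andP; split;
  apply: (@le_measureU_null _ _ _ (@lebesgue_measure R) _ _ N) => //.
- move=> t /= ; rewrite in_itv/= => /andP[t0 tm].
  have [Nt|Nt] := pselect (N t); [by right|left].
  have t01 : t \in `]0, 1] by rewrite in_itv/= t0 (le_trans (ltW tm)).
  by split; rewrite //= restrict01E// in_itv/= andbT key.
- move=> t /= [+ t01]; rewrite restrict01E// in_itv/= andbT => gt.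
  have [Nt|Nt] := pselect (N t); [by right|left].
  by rewrite in_itv/= -key// gt andbT; move: t01; rewrite in_itv/= => /andP[].
Qed.

(* With [y := g e], [phi <= y + (phi - y)^+] and [(g - y)^+] vanishes beyond [e]. *)
Lemma equidistributed_integral_le (phi : X -> measurableTypeR R) (E : set X) (e : R) :
  measurable_fun setT phi -> (forall x, 0 <= phi x) -> equidistributed phi ->
  measurable E -> mu E = e%:E -> 0 < e -> e <= 1 ->
  (\int[mu]_(x in E) (phi x)%:E <=
   \int[lebesgue_measure]_(t in `]0%R, e]) (g t)%:E)%E.
Proof.
move=> mphi phi0 eqphi mE muE e0 e1; set y := g e.
have e01 : e \in `]0, 1] by rewrite in_itv/= e0.
have y0 : 0 <= y by exact: g_ge0.
pose f (r : measurableTypeR R) := (Num.max (r - y) 0)%:E.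
have f0 r : (0 <= f r)%E by rewrite lee_fin le_max lexx orbT.
have mf : measurable_fun setT f.
  apply/measurable_EFinP; apply: measurable_maxr => //.
  by apply: measurable_funB.
have mphif : measurable_fun setT (f \o phi) by exact: measurableT_comp.
have mgf : measurable_fun setT (f \o restrict01).
  by apply: measurableT_comp => //; exact: measurable_restrict01.
have sub_e : `]0%R, e]%classic `<=` `]0%R, 1%R]%classic.
  by move=> t /=; rewrite !in_itv/= => /andP[-> /le_trans->].
apply: (@le_trans _ _ (\int[mu]_(x in E) (y%:E + f (phi x)))%E).
  apply: ge0_le_integral => //.
  - by move=> x _; rewrite lee_fin.
  - by apply/measurable_EFinP; exact: measurable_funTS.
  - by apply: emeasurable_funD => //; exact: measurable_funTS.
  - by move=> x _; rewrite -EFinD lee_fin -lerBlDl le_max lexx.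
rewrite ge0_integralD//; last by exact: measurable_funTS.
rewrite integral_cst// muE.
apply: (@le_trans _ _ (y%:E * e%:E + \int[mu]_x f (phi x))%E).
  by rewrite leeD2l//; apply: ge0_subset_integral => // x _; exact: f0.
have m01 := measurable_itv (`]0, 1] : interval R).
have m0e := measurable_itv (`]0, e] : interval R).
rewrite (ge0_integral_same_law (m2 := @lebesgue_measure R) measurableT m01 mphi measurable_restrict01 ler01 eqphi mf f0).
rewrite mul1e.
have -> : (\int[lebesgue_measure]_(t in `]0%R, 1%R]) f (restrict01 t) =
    \int[lebesgue_measure]_(t in `]0%R, e]) f (restrict01 t))%E.
  rewrite integral_mkcond [RHS]integral_mkcond; apply: eq_integral => t _.
  rewrite !patchE; case: ifPn => [t01|]; case: ifPn => //.
    rewrite inE in t01; rewrite notin_setE/= => te.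
    move: (t01); rewrite /= in_itv/= => /andP[t0 t1].
    rewrite /f restrict01E//; congr EFin; apply/max_idPr; rewrite subr_le0.
    apply: g_noninc => //; rewrite leNgt; apply/negP => te'; apply: te.
    by rewrite in_itv/= t0 ltW.
  by rewrite inE => /sub_e t01; rewrite notin_setE.
have -> : (y%:E * e%:E = \int[lebesgue_measure]_(t in `]0%R, e]) (cst y%:E t))%E.
  by rewrite integral_cst//= lebesgue_measure_itv/= lte_fin e0 oppr0 adde0.
rewrite -ge0_integralD//; last by exact: measurable_funTS.
apply: ge0_le_integral => //.
- by move=> t _; rewrite adde_ge0.
- by apply: emeasurable_funD => //; exact: measurable_funTS.
- apply/measurable_EFinP; apply: nonincreasing_in_measurable => t u t01 u01.
  by apply: g_noninc; apply: sub_e.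
- move=> t te; rewrite /f restrict01E; last exact: sub_e.
  rewrite -EFinD lee_fin; have yg : y <= g t.
    by apply: g_noninc => //; [exact: sub_e|move: te; rewrite /= in_itv => /andP[]].
  by rewrite (max_idPl _) ?subr_ge0// addrC subrK.
Qed.

End equidistribution.

(** * The upper bound *)

Section hardy.
Context (R : realType) (g : R -> R).
Context (g_ge0 : forall t, t \in `]0, 1] -> 0 <= g t).
Context (g_noninc : {in `]0, 1] &, nonincreasing_fun g}).
Context (g_int : lebesgue_measure.-integrable `]0, 1] (EFin \o g)).

Definition hardy (t : R) : R := t^-1 * \int[lebesgue_measure]_(u in `]0, t]) g u.

Let sub01 (t : R) : t \in `]0, 1] -> `]0, t]%classic `<=` `]0, 1]%classic.
Proof.
rewrite in_itv/= => /andP[_ t1] u /=; rewrite !in_itv/= => /andP[-> /le_trans].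
exact.
Qed.

Lemma hardyE (t : R) : t \in `]0, 1] ->
  (\int[lebesgue_measure]_(u in `]0%R, t]) (g u)%:E = (t * hardy t)%:E)%E.
Proof.
move=> t01; have t0 : t != 0 by move: t01; rewrite in_itv/= => /andP[/gt_eqF->].
rewrite /hardy mulrA divff// mul1r /Rintegral fineK//.
have : lebesgue_measure.-integrable `]0, t] (EFin \o g).
  exact: (integrableS (mu := @lebesgue_measure R) (measurable_itv _)
    (measurable_itv _) (sub01 t01) g_int).
by move/integrable_fin_num; apply; exact: measurable_itv.
Qed.

Lemma hardy_ge0 (t : R) : t \in `]0, 1] -> 0 <= hardy t.
Proof.
move=> t01; have t0 : 0 < t by move: t01; rewrite in_itv/= => /andP[].
apply: mulr_ge0; first by rewrite invr_ge0 ltW.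
apply: fine_ge0; apply: integral_ge0.
by move=> u /(sub01 t01) u01; rewrite lee_fin g_ge0.
Qed.

(** The value [g s] is at most the mean over (0, s] and at least every value on (s, t], so
    lengthening the interval cannot raise the mean. *)
Lemma hardy_noninc : {in `]0, 1] &, nonincreasing_fun hardy}.
Proof.
move=> s t s01 t01 st.
have [s0 t0] : 0 < s /\ 0 < t.
  by move: s01 t01; rewrite !in_itv/= => /andP[? _] /andP[].
have [->//|nst] := eqVneq s t.
have {}st : s < t by rewrite lt_neqAle nst.
have mg : measurable_fun (`]0, 1]%classic : set R) (EFin \o g).
  by apply/measurable_EFinP; exact: nonincreasing_in_measurable.
have E : `]0, t]%classic = `]0, s]%classic `|` `]s, t]%classic :> set R.
  by rewrite -itv_bndbnd_setU// bnd_simp ltW.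
have mgS A : A `<=` `]0, t]%classic -> measurable_fun A (EFin \o g).
  by move=> At; apply: measurable_funS mg => //; exact: subset_trans (sub01 t01).
have st01 u : `]s, t]%classic u -> u \in `]0, 1].
  by move=> su; apply: (sub01 t01); rewrite E; right.
have gs : (s%:E * (g s)%:E <= \int[lebesgue_measure]_(u in `]0%R, s]) (g u)%:E)%E.
  have -> : (s%:E * (g s)%:E =
      \int[lebesgue_measure]_(u in `]0%R, s]) (cst (g s)%:E u))%E.
    by rewrite integral_cst//= lebesgue_measure_itv/= lte_fin s0 oppr0 adde0 muleC.
  apply: ge0_le_integral => //.
  - by move=> u _; rewrite lee_fin g_ge0.
  - by apply: mgS; rewrite E; left.
  - move=> u us; rewrite lee_fin; apply: g_noninc => //; first exact: (sub01 s01).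
    by move: us; rewrite /= in_itv/= => /andP[].
have gt : (\int[lebesgue_measure]_(u in `]s, t]) (g u)%:E <= ((t - s) * g s)%:E)%E.
  have -> : (((t - s) * g s)%:E =
      \int[lebesgue_measure]_(u in `]s, t]) (cst (g s)%:E u))%E.
    by rewrite integral_cst//= lebesgue_measure_itv/= lte_fin st -EFinB -EFinM mulrC.
  apply: ge0_le_integral => //.
  - by move=> u /st01 u01; rewrite lee_fin g_ge0.
  - by apply: mgS; rewrite E; right.
  - move=> u us; rewrite lee_fin; apply: g_noninc => //; first exact: st01.
    by move: us; rewrite /= in_itv/= => /andP[/ltW].
have Ht := hardyE t01; rewrite E ge0_integral_setU// in Ht; last 3 first.
- by rewrite -E; apply: mgS.
- by move=> u; rewrite -E => /(sub01 t01) u01; rewrite lee_fin g_ge0.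
- rewrite disj_set2E; apply/eqP/seteqP; split=> // u [/=]; rewrite !in_itv/=.
  by move=> /andP[_ us] /andP[su _]; have := le_lt_trans us su; rewrite ltxx.
rewrite (hardyE s01) in Ht gs.
have : ((t * hardy t)%:E <= (s * hardy s + (t - s) * g s)%:E)%E.
  by rewrite -Ht EFinD leeD2l.
move: gs; rewrite -EFinM !lee_fin ler_pM2l// => gs h.
rewrite -(ler_pM2l t0); apply: le_trans h _.
have -> : t * hardy s = s * hardy s + (t - s) * hardy s by ring.
by rewrite lerD2l ler_wpM2l// subr_ge0 ltW.
Qed.

End hardy.

Section maximal_upper.
Context d (X : measurableType d) (R : realType).
Context (mu : {measure set X -> \bar R}) (mu1 : mu setT = 1%E).
Context (T : set (set X)) (L : nat -> set (set X)) (TL : tree_filtration mu T L).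
Context (g : R -> R) (g_ge0 : forall t, t \in `]0, 1] -> 0 <= g t).
Context (g_noninc : {in `]0, 1] &, nonincreasing_fun g}).
Context (g_int : lebesgue_measure.-integrable `]0, 1] (EFin \o g)).
Context (phi : X -> R) (mphi : measurable_fun setT phi).
Context (phi_ge0 : forall x, 0 <= phi x) (phi_g : equidistributed mu g phi).

Let mu_fin : fin_num_fun mu := mass1_fin_num_fun mu1.

Lemma average_gt (s : R) J : T J ->
  (s%:E < (\int[mu]_(y in J) `|phi y|%:E) / mu J)%E <->
  (s%:E * mu J < \int[mu]_(y in J) (phi y)%:E)%E.
Proof.
move=> TJ; have J0 := tree_gt0 TL TJ; have mJ := tree_measurable TL TJ.
have JE : mu J = (fine (mu J))%:E by rewrite fineK// mu_fin.
have j0 : 0 < fine (mu J) by rewrite -lte_fin -JE.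
rewrite JE inver gt_eqF// lte_pdivlMr//.
by under eq_integral do rewrite ger0_norm//.
Qed.

Lemma dyadic_maximal_gtE (s : R) :
  [set x | s%:E < dyadic_maximal mu T phi x]%E =
  \bigcup_(J in [set J | T J /\
     (s%:E * mu J < \int[mu]_(y in J) (phi y)%:E)%E]) J.
Proof.
apply/seteqP; split=> x /=.
  rewrite ltNge => sM; apply: contrapT => nx; move/negP: sM; apply.
  apply: ge_ereal_sup => _ [J [TJ Jx] <-]; rewrite leNgt; apply/negP.
  by move=> /(average_gt _ TJ) sJ; apply: nx; exists J.
move=> [J [TJ sJ] Jx]; apply: (@lt_le_trans _ _ ((\int[mu]_(y in J) `|phi y|%:E) / mu J)%E).
  exact/average_gt.
by apply: ereal_sup_ubound; exists J.
Qed.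

Lemma dyadic_maximal_ge0 x : (0 <= dyadic_maximal mu T phi x)%E.
Proof.
have [J LJ Jx] := tree_cover TL 0%N x; have TJ := tree_level_sub TL LJ.
apply: (@le_trans _ _ ((\int[mu]_(y in J) `|phi y|%:E) / mu J)%E).
  by rewrite mule_ge0 ?inve_ge0// integral_ge0// => y _; rewrite lee_fin.
by apply: ereal_sup_ubound; exists J.
Qed.

Lemma rearrangement_maximal_le (t : R) : t \in `]0, 1] ->
  (rearrangement mu (dyadic_maximal mu T phi) t <= (hardy g t)%:E)%E.
Proof.
move=> t01; have t0 : 0 < t by move: t01; rewrite in_itv/= => /andP[].
(* The level s lies strictly above [hardy g t]. If the set E where the maximal function exceeds s
   had measure e > t, then s e <= e [hardy g e] <= e [hardy g t] < e s, a contradiction. *)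
apply/lee_addgt0Pr => _/posnumP[eps]; rewrite -EFinD.
have hs : hardy g t < hardy g t + eps%:num by rewrite ltrDl.
have := hardy_ge0 g_ge0 t01; move: hs.
move: (hardy g t + eps%:num) => s hs h0; have s0 : 0 <= s by rewrite (le_trans h0)// ltW.
apply: ereal_inf_lbound; exists s => //; split => //.
rewrite leNgt; apply/negP.
rewrite (_ : [set x | _] = [set x | s%:E < dyadic_maximal mu T phi x]%E); last first.
  by apply/seteqP; split=> x /=; rewrite gee0_abs// dyadic_maximal_ge0.
rewrite dyadic_maximal_gtE; set A := [set J | _].
have AT : A `<=` T by move=> J [].
rewrite -(bigcup_maximal_cells TL AT); set M := maximal_cells A.
have MT : M `<=` T by move=> J [/AT].
have mE := tree_bigcup_measurable TL MT; set E := \bigcup_(J in M) J in mE *.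
have [e eE] : exists e, mu E = e%:E by exists (fine (mu E)); rewrite fineK// mu_fin.
rewrite eE lte_fin => te; have e0 : 0 < e := lt_trans t0 te.
have e1 : e <= 1.
  by rewrite -lee_fin -eE -mu1; apply: le_measure; rewrite ?inE.
have e01 : e \in `]0, 1] by rewrite in_itv/= e0.
have le1 : (\int[mu]_(x in E) (phi x)%:E <= (e * hardy g e)%:E)%E.
  by rewrite -hardyE//; apply: equidistributed_integral_le.
have le2 : (s%:E * mu E <= \int[mu]_(x in E) (phi x)%:E)%E.
  have [F [FM MF tF]] := countable_family_seq (subset_tree_countable TL MT).
  have mF n : measurable (F n).
    by have [->|/MT/(tree_measurable TL)] := FM n; first exact: measurable0.
  have tF' : trivIset setT F := tF (maximal_cells_trivIset TL AT).
  have EF : E = \bigcup_n F n := bigcup_family_seq FM MF.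
  rewrite {1}EF measure_semi_bigcup//; last by rewrite -EF.
  rewrite EF ge0_integral_bigcup//; last 2 first.
    by apply/measurable_EFinP; exact: measurable_funTS.
    by move=> x _; rewrite lee_fin.
  rewrite -nneseriesZl//; apply: lee_nneseries => [n _ _|n _].
    by rewrite mule_ge0.
  have [->|[[_ /ltW//]]] := FM n; by rewrite measure0 mule0 integral_set0.
have := le_trans le2 le1; rewrite eE -EFinM lee_fin mulrC ler_pM2l//.
rewrite leNgt => /negP; apply; apply: le_lt_trans hs.
by apply: (hardy_noninc g_ge0 g_noninc g_int) => //; exact: ltW.
Qed.

End maximal_upper.

(** After replacing [f1] by [f], the sets K minus (0, k] and (0, k] minus K have equal measure, and
    [f k] bounds [f] from above on the first and from below on the second. Monotonicity of [f1]
    provides its measurability. *)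
Lemma integral_le_initial (R : realType) (f f1 : R -> R) (K : set R) (k : R) :
  (forall t, t \in `]0, 1] -> 0 <= f t) ->
  {in `]0, 1] &, nonincreasing_fun f} ->
  (forall t, t \in `]0, 1] -> 0 <= f1 t <= f t) ->
  {in `]0, 1] &, nonincreasing_fun f1} ->
  measurable K -> K `<=` `[0, 1] -> lebesgue_measure K = k%:E -> 0 < k -> k <= 1 ->
  (\int[lebesgue_measure]_(t in K) (f1 t)%:E <=
   \int[lebesgue_measure]_(t in `]0%R, k]) (f t)%:E)%E.
Proof.
move=> f0 fni f1f f1ni mK K01 muK k0 k1.
have k01 : k \in `]0, 1] by rewrite in_itv/= k0.
have mf : measurable_fun (`]0, 1]%classic : set R) (EFin \o f).
  by apply/measurable_EFinP; exact: nonincreasing_in_measurable.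
have mf1 : measurable_fun (`]0, 1]%classic : set R) (EFin \o f1).
  by apply/measurable_EFinP; exact: nonincreasing_in_measurable.
have m01 := measurable_itv (`]0, 1] : interval R).
have m0k := measurable_itv (`]0, k] : interval R).
(* [K] may contain 0, where nothing is known about the integrands. *)
pose K0 : set R := K `\ 0.
have mK0 : measurable K0 by apply: measurableD.
have K001 : K0 `<=` `]0, 1]%classic.
  move=> t [/K01/=]; rewrite !in_itv/= => /andP[t0 ->] /eqP tn0.
  by rewrite lt_neqAle eq_sym tn0 t0.
have sub_k : `]0, k]%classic `<=` (`]0, 1]%classic : set R).
  by move=> t /=; rewrite !in_itv/= => /andP[-> /le_trans->].
have muK0 : lebesgue_measure K0 = k%:E.
  have : lebesgue_measure K =
      (lebesgue_measure K0 + lebesgue_measure (K `&` [set (0 : R)%R]))%E.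
    exact: measureDI.
  rewrite muK => ->.
  rewrite [X in (_ + X)%E](_ : _ = 0%E) ?adde0//.
  apply: (@subset_measure0 _ _ _ (@lebesgue_measure R) _ [set (0 : R)]) => //.
  - by apply: measurableI.
  - exact: lebesgue_measure_set1.
have mu0k : lebesgue_measure (`]0, k]%classic : set R) = k%:E.
  by rewrite lebesgue_measure_itv/= lte_fin k0 oppr0 adde0.
rewrite -(@integral_setD1 _ _ 0 K)//; last exact: measurable_funS mf1.
apply: (@le_trans _ _ (\int[lebesgue_measure]_(t in K0) (f t)%:E)%E).
  apply: ge0_le_integral => //.
  - by move=> t /K001/f1f; rewrite lee_fin => /andP[].
  - exact: measurable_funS mf1.
  - exact: measurable_funS mf.
  - by move=> t /K001/f1f; rewrite lee_fin => /andP[].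
have mA : measurable (K0 `&` `]0, k]%classic) by exact: measurableI.
have mB : measurable (K0 `\` `]0, k]%classic) by exact: measurableD.
have mC : measurable (`]0, k]%classic `\` K0) by exact: measurableD.
have split_int (S1 S2 : set R) : measurable S1 -> measurable S2 ->
    S1 `<=` `]0, 1]%classic ->
    (\int[lebesgue_measure]_(t in S1) (f t)%:E =
     \int[lebesgue_measure]_(t in S1 `&` S2) (f t)%:E +
     \int[lebesgue_measure]_(t in S1 `\` S2) (f t)%:E)%E.
  move=> mS1 mS2 S101; rewrite -ge0_integral_setU//; first last.
  - by rewrite disj_set2E setDE setIACA setICr setI0.
  - by move=> t; rewrite setUIDK => /S101 t01; rewrite lee_fin f0.
  - by rewrite setUIDK; exact: measurable_funS mf.
  - exact: measurableD.
  - exact: measurableI.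
  - by rewrite setUIDK.
rewrite (split_int K0 _ mK0 m0k K001) (split_int _ _ m0k mK0 sub_k) setIC leeD2l//.
(* Both sets complete the same intersection to a set of measure k; its measure is finite, hence can
   be cancelled. *)
have BC : lebesgue_measure (K0 `\` `]0, k]) = lebesgue_measure (`]0, k] `\` K0).
  have [x _ xE] := lebesgue_measure_itv_fin 0 k mK0.
  have h1 : lebesgue_measure K0 = (lebesgue_measure (K0 `\` `]0%R, k]) +
      lebesgue_measure (K0 `&` `]0%R, k]))%E by exact: measureDI.
  have h2 : lebesgue_measure (`]0, k]%classic : set R) =
      (lebesgue_measure (`]0%R, k] `\` K0) + lebesgue_measure (`]0%R, k] `&` K0))%E.
    exact: measureDI.
  rewrite muK0 xE in h1; rewrite mu0k setIC xE in h2.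
  by rewrite -[LHS](@addeK _ x%:E)// -h1 h2 addeK.
apply: (@le_trans _ _ ((f k)%:E * lebesgue_measure (K0 `\` `]0%R, k]))%E).
  rewrite -[X in (_ <= X)%E](integral_cst (@lebesgue_measure R) mB).
  apply: ge0_le_integral => //.
  - by move=> t [/K001 t01 _]; rewrite lee_fin f0.
  - by apply: measurable_funS mf => // t [/K001].
  - move=> t [K0t /= tk]; rewrite lee_fin; apply: fni => //; first exact: K001.
    move: (K001 _ K0t) tk; rewrite /= !in_itv/= => /andP[-> _] /negP.
    by rewrite -ltNge => /ltW.
rewrite BC -[X in (X <= _)%E](integral_cst (@lebesgue_measure R) mC).
apply: ge0_le_integral => //.
- by move=> t _; rewrite lee_fin f0.
- by apply: measurable_funS mf => // t [/sub_k].
- move=> t [tk _]; rewrite lee_fin; apply: fni => //; first exact: sub_k.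
  by move: tk; rewrite /= in_itv/= => /andP[].
Qed.

(** * The lower bound *)

Section rearrangement_ae.
Context d (X : measurableType d) (R : realType) (mu : {measure set X -> \bar R}).
Context (g : R -> R) (g_ge0 : forall t, t \in `]0, 1] -> 0 <= g t).
Context (g_noninc : {in `]0, 1] &, nonincreasing_fun g}).

(** The rearrangement is right-continuous and may fall below [g] at a jump, and also at t = 1, where
    it is 0. Such points are separated by rationals, hence countable and negligible. *)
Lemma equidistributed_rearrangement (phi : X -> R) :
  measurable_fun setT phi -> (forall x, 0 <= phi x) -> equidistributed mu g phi ->
  {ae lebesgue_measure, forall t : R, t \in `]0, 1] ->
     rearrangement mu (EFin \o phi) t = (g t)%:E}.
Proof.
move=> mphi phi0 eqphi.
have rho_gt (s t : R) : 0 <= s -> (s%:E < rearrangement mu (EFin \o phi) t)%E <->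
    (t%:E < lebesgue_measure ([set u | (s < g u)%R] `&` `]0%R, 1%R]%classic))%E.
  move=> s0; have mpsi : measurable_fun setT (EFin \o phi) by exact/measurable_EFinP.
  apply: (iff_trans (rearrangement_gt mu t mpsi s0)).
  rewrite (_ : [set x | _] = phi @^-1` `]s, +oo[ `&` setT); last first.
    by apply/seteqP; split=> x /=; rewrite in_itv/= andbT lte_fin ger0_norm//; case.
  rewrite (eqphi _ (measurable_itv _)) mul1e (_ : _ `&` _ = [set u | s < g u] `&` `]0, 1])//.
  by apply/seteqP; split=> u /= [+ u01]; rewrite in_itv/= andbT restrict01E.
pose N := [set t | t \in `]0, 1] /\ rearrangement mu (EFin \o phi) t != (g t)%:E].
have rho0 (t : R) : (0 <= rearrangement mu (EFin \o phi) t)%E.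
  by apply: le_ereal_inf_tmp => _ [s [s0 _] <-]; rewrite lee_fin.
have measurable_ray s : measurable ([set u | s < g u] `&` `]0, 1]%classic).
  rewrite setIC (_ : [set u | s < g u] = g @^-1` `]s, +oo[).
    apply: (nonincreasing_in_measurable g_noninc); exact: measurable_itv.
  by apply/seteqP; split=> u /=; rewrite in_itv/= andbT.
have meas_le (t : R) : t \in `]0, 1] ->
    (lebesgue_measure ([set u | (g t < g u)%R] `&` `]0%R, 1%R]) <= t%:E)%E.
  move=> t01; have /andP[t0 t1] : 0 < t <= 1 by rewrite in_itv in t01.
  have <- : lebesgue_measure (`]0, t]%classic : set R) = t%:E.
    by rewrite lebesgue_measure_itv/= lte_fin t0 oppr0 adde0.
  apply: le_measure; rewrite ?inE//; first exact: measurable_ray.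
  move=> u [/= gtu u01]; move: (u01); rewrite /= !in_itv/= => /andP[-> _] /=.
  rewrite leNgt; apply/negP => tu; move: gtu; apply/negP; rewrite -leNgt.
  by apply: g_noninc => //; exact: ltW.
have meas_ge (t q : R) : t \in `]0, 1] -> q < g t ->
    (t%:E <= lebesgue_measure ([set u | (q < g u)%R] `&` `]0%R, 1%R]))%E.
  move=> t01 qt; have /andP[t0 t1] : 0 < t <= 1 by rewrite in_itv in t01.
  have <- : lebesgue_measure (`]0, t]%classic : set R) = t%:E.
    by rewrite lebesgue_measure_itv/= lte_fin t0 oppr0 adde0.
  apply: le_measure; rewrite ?inE//; first exact: measurable_ray.
  move=> u /=; rewrite !in_itv/= => /andP[u0 ut].
  have u01 : u \in `]0, 1] by rewrite in_itv/= u0 (le_trans ut).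
  by rewrite u0 (le_trans ut)//; split=> //; apply: lt_le_trans qt _; exact: g_noninc.
have Nlt t : N t -> (rearrangement mu (EFin \o phi) t < (g t)%:E)%E.
  move=> [t01 neq]; rewrite lt_neqAle neq/= leNgt; apply/negP.
  by move=> /rho_gt -/(_ (g_ge0 t01)); apply/negP; rewrite -leNgt meas_le.
have /choice[q qP] : forall t, exists q : rat, N t ->
    (rearrangement mu (EFin \o phi) t < (ratr q)%:E)%E /\ ratr q < g t.
  move=> t; have [Nt|nNt] := pselect (N t); last by exists 0.
  move: (Nlt _ Nt) (rho0 t); case: (rearrangement _ _ _) => [r| |]//.
  rewrite lte_fin => /rat_in_itvoo[q]; rewrite in_itv/= => /andP[rq qg] _.
  by exists q; rewrite lte_fin.
(* A rational strictly between the two values at a point of [N] determines it. *)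
suff cN : countable N.
  exists N; split.
  - by apply: countable_measurable.
  - exact: countable_lebesgue_measure0.
  - by move=> t /= /not_implyP[t01 neq]; split=> //; apply/eqP.
apply/countable_injP.
exists (pickle \o q) => t1 t2; rewrite !inE => Nt1 Nt2 /= /(pcan_inj pickleK).
wlog : t1 t2 Nt1 Nt2 / t1 < t2 => [wl|t12] qq.
  by case: (ltgtP t1 t2) => // [/wl->//|/wl]; move=> ->.
have [r1q _] := qP _ Nt1; have [r2q q2g] := qP _ Nt2; exfalso.
move: r1q; apply/negP; rewrite -leNgt; apply/ltW/rho_gt.
  by rewrite -lee_fin qq (le_trans (rho0 t2))// ltW.
by rewrite qq (@lt_le_trans _ _ t2%:E) ?lte_fin//; apply: meas_ge => //; case: Nt2.
Qed.

End rearrangement_ae.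

Lemma nonincreasing_comp_weight (R : realType) (G h H : R -> R) :
  (forall y, 0 <= y -> 0 <= G y) -> {in `[0, +oo[ &, nondecreasing_fun G} ->
  (forall t, t \in `]0, 1] -> 0 <= h t) -> {in `]0, 1] &, nonincreasing_fun h} ->
  (forall t, t \in `]0, 1] -> 0 <= H t) -> {in `]0, 1] &, nonincreasing_fun H} ->
  (forall t, t \in `]0, 1] -> 0 <= G (H t) * h t) /\
  {in `]0, 1] &, nonincreasing_fun (fun t => G (H t) * h t)}.
Proof.
move=> G0 Gnd h0 hni H0 Hni; split=> [t t01|s t s01 t01 st].
  by rewrite mulr_ge0 ?h0 ?G0 ?H0.
apply: ler_pM; rewrite ?h0 ?G0 ?H0 ?hni//.
by apply: Gnd; rewrite ?in_itv/= ?andbT ?H0// Hni.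
Qed.

Section maximal_lower.
Context d (X : measurableType d) (R : realType).
Context (mu : {measure set X -> \bar R}) (mu1 : mu setT = 1%E).
Context (T : set (set X)) (L : nat -> set (set X)) (TL : tree_filtration mu T L).
Context (g : R -> R) (g_ge0 : forall t, t \in `]0, 1] -> 0 <= g t).
Context (g_noninc : {in `]0, 1] &, nonincreasing_fun g}).
Context (g_int : lebesgue_measure.-integrable `]0, 1] (EFin \o g)).
Context (V : X -> measurableTypeR R) (mV : measurable_fun setT V).

Let phi x : R := restrict01 g (V x).

Let mu_fin : fin_num_fun mu := mass1_fin_num_fun mu1.

Let phi_ge0 x : 0 <= phi x.
Proof. exact: restrict01_ge0. Qed.

Let mphi : measurable_fun setT phi.
Proof. exact: (measurableT_comp (measurable_restrict01 g_noninc) mV). Qed.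

(** The reason for wanting uniform cells: the mean of [phi] over such a cell is exactly [hardy g b],
    so the maximal function is at least that on the whole cell. *)
Lemma uniform_on_integral J b : measurable J -> b \in `]0, 1] -> uniform_on mu J V b ->
  (\int[mu]_(x in J) (phi x)%:E = mu J * (hardy g b)%:E)%E.
Proof.
move=> mJ b01 uJ; have b0 : 0 < b by move: b01; rewrite in_itv/= => /andP[].
have [j jE] : exists j, mu J = j%:E by exists (fine (mu J)); rewrite fineK// mu_fin.
have j0 : 0 <= j by rewrite -lee_fin -jE.
have c0 : 0 <= b^-1 * j by rewrite mulr_ge0// invr_ge0 ltW.
pose f (r : measurableTypeR R) := (restrict01 g r)%:E.
have mf : measurable_fun setT f.
  by apply/measurable_EFinP; exact: measurable_restrict01.
have f0 r : (0 <= f r)%E by rewrite lee_fin restrict01_ge0.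
have mb := measurable_itv (`]0, b] : interval R).
have := @ge0_integral_same_law _ _ X _ R mu (@lebesgue_measure R) J `]0, b]%classic
  V id (b^-1 * j) f mJ mb mV.
move=> /(_ (@measurable_id _ _ _) c0) law; rewrite /phi law//; last first.
  by move=> B mB; rewrite uJ// jE -EFinM.
have -> : (\int[lebesgue_measure]_(y in `]0%R, b]) f (id y) =
    \int[lebesgue_measure]_(y in `]0%R, b]) (g y)%:E)%E.
  apply: eq_integral => t; rewrite inE /= => tb; rewrite /f restrict01E//.
  move: tb b01; rewrite !in_itv/= => /andP[-> tb] /andP[_ b1].
  exact: le_trans b1.
rewrite (hardyE g_int b01) jE -!EFinM; congr EFin; field.
by rewrite gt_eqF.
Qed.

Lemma uniform_equidistributed : uniform_on mu setT V 1 -> equidistributed mu g phi.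
Proof.
move=> uV B mB; rewrite -[X in mu X]/(V @^-1` (restrict01 g @^-1` B) `&` setT).
rewrite uV; first by rewrite invr1 mu1 !mul1e.
by rewrite -[_ @^-1` _]setTI; apply: measurable_restrict01.
Qed.

Lemma uniform_integrable : uniform_on mu setT V 1 -> mu.-integrable setT (EFin \o phi).
Proof.
move=> uV; apply/integrableP; split; first exact/measurable_EFinP.
have -> : (\int[mu]_x `|(EFin \o phi) x| = \int[mu]_x (phi x)%:E)%E.
  by apply: eq_integral => x _; rewrite /= ger0_norm.
have one01 : 1 \in `]0, (1 : R)] by rewrite in_itv/= ltr01 lexx.
rewrite [ltLHS](uniform_on_integral measurableT one01 uV).
by rewrite mu1 mul1e ltry.
Qed.

(** For s below [hardy g b] the maximal function exceeds s on all the uniform cells, whose union has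
    measure at least b > t, so s is not admissible in the infimum defining the rearrangement at
    t. *)
Lemma rearrangement_maximal_ge (b t : R) : b \in `]0, 1] -> t < b ->
  (b%:E <= mu (\bigcup_(J in uniform_cells mu T setT V b) J))%E ->
  ((hardy g b)%:E <= rearrangement mu (dyadic_maximal mu T phi) t)%E.
Proof.
move=> b01 tb bE; apply: le_ereal_inf_tmp => _ [s [s0 st] <-].
rewrite lee_fin leNgt; apply/negP => sb; move: st; apply/negP; rewrite -ltNge.
apply: (@lt_le_trans _ _ b%:E); rewrite ?lte_fin//; apply: le_trans bE _.
rewrite (_ : [set x | _] = [set x | s%:E < dyadic_maximal mu T phi x]%E); last first.
  apply/seteqP; split=> x /=; rewrite gee0_abs//.
    exact: (dyadic_maximal_ge0 TL).
  exact: (dyadic_maximal_ge0 TL).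
rewrite (dyadic_maximal_gtE mu1 TL)//.
apply: le_measure; rewrite ?inE.
- by apply: (tree_bigcup_measurable TL) => J [].
- by apply: (tree_bigcup_measurable TL) => J [].
move=> x [J [TJ _ uJ] Jx]; exists J => //; split=> //.
have mJ := tree_measurable TL TJ.
rewrite (uniform_on_integral mJ b01 uJ) muleC lte_pmul2l ?lte_fin//.
- by rewrite mu_fin.
- exact: (tree_gt0 TL).
Qed.

End maximal_lower.

(** Substituting t/a turns the left side into the integral of f(t/a) over (au, ak], an interval
    inside (0, k] on which [f1] dominates. The factor a is the Jacobian. *)
Lemma integral_dilation_le (R : realType) (f f1 : R -> R) (a u k : R) :
  (forall t, t \in `]0, 1] -> 0 <= f t) ->
  {in `]0, 1] &, nonincreasing_fun f} ->
  (forall t, t \in `]0, 1] -> 0 <= f1 t) ->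
  {in `]0, 1] &, nonincreasing_fun f1} ->
  0 < a < 1 -> 0 < u -> k <= 1 ->
  (forall t, a * u < t <= a * k -> f (a^-1 * t) <= f1 t) ->
  (a%:E * \int[lebesgue_measure]_(t in `]u, k]) (f t)%:E <=
   \int[lebesgue_measure]_(t in `]0%R, k]) (f1 t)%:E)%E.
Proof.
move=> f0 fni f10 f1ni /andP[a0 a1] u0 k1 ff1.
have mD1 := measurable_itv (`](a * u), (a * k)] : interval R).
have mD2 := measurable_itv (`]u, k] : interval R).
have a0' : 0 < a^-1 by rewrite invr_gt0.
pose F (r : measurableTypeR R) := (restrict01 f r)%:E.
have mF : measurable_fun setT F.
  by apply/measurable_EFinP; exact: measurable_restrict01.
have F0 r : (0 <= F r)%E by rewrite lee_fin restrict01_ge0.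
have mV : measurable_fun [set: measurableTypeR R]
    (fun x : measurableTypeR R => 0 + a^-1 * x : measurableTypeR R).
  by apply: measurable_funD => //; apply: measurable_funM.
have := @ge0_integral_same_law _ _ _ _ R (@lebesgue_measure R) (@lebesgue_measure R)
  `](a * u), (a * k)]%classic `]u, k]%classic
  (fun x : measurableTypeR R => 0 + a^-1 * x : measurableTypeR R) id a F
  mD1 mD2 mV (@measurable_id _ _ _) (ltW a0).
move=> law.
have -> : (\int[lebesgue_measure]_(t in `]u, k]) (f t)%:E =
    \int[lebesgue_measure]_(t in `]u, k]) F (id t))%E.
  apply: eq_integral => t; rewrite inE /= in_itv/= => /andP[ut tk].
  by rewrite /F restrict01E// in_itv/= (lt_trans u0 ut) (le_trans tk).
rewrite -law//; last first.
  move=> B mB; have mBD : measurable (B `&` `]u, k]%classic) by exact: measurableI.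
  rewrite -[X in (_ * X)%E](lebesgue_measure_affine 0 a0' mBD) muleA -EFinM.
  rewrite divff ?gt_eqF// mul1e preimage_setI; congr lebesgue_measure.
  congr (_ `&` _); apply/seteqP; split=> x /=; rewrite !in_itv/= add0r.
    by rewrite ltr_pdivlMl// ler_pdivrMl//.
  by rewrite ltr_pdivlMl// ler_pdivrMl//.
have m0k := measurable_itv (`]0, k] : interval R).
have sub_k : `]0, k]%classic `<=` (`]0, 1]%classic : set R).
  by move=> t /=; rewrite !in_itv/= => /andP[-> /le_trans->].
have mf1 : measurable_fun (`]0, k]%classic : set R) (EFin \o f1).
  apply: (@measurable_funS _ _ _ _ (`]0, 1]%classic : set R)) => //.
  by apply/measurable_EFinP; exact: nonincreasing_in_measurable.
have D1k : `](a * u), (a * k)]%classic `<=` (`]0, k]%classic : set R).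
  move=> t /=; rewrite !in_itv/= => /andP[ut tk].
  have au0 : 0 < a * u by rewrite mulr_gt0.
  rewrite (lt_trans au0 ut) (le_trans tk)//.
  have k0 : 0 < k by rewrite -(pmulr_rgt0 _ a0) (lt_le_trans _ tk)// (lt_trans au0).
  by rewrite ler_piMl// ltW.
apply: (@le_trans _ _ (\int[lebesgue_measure]_(t in `](a * u)%R, (a * k)%R]) (f1 t)%:E)%E).
  apply: ge0_le_integral => //.
  - exact: (measurable_funTS (measurableT_comp mF mV)).
  - exact: measurable_funS mf1.
  move=> t /=; rewrite in_itv/= => tau; rewrite /F add0r lee_fin restrict01E ?ff1//.
  move: tau => /andP[ut tk]; rewrite in_itv/= pmulr_rgt0//.
  rewrite (lt_trans _ ut) ?mulr_gt0//= ler_pdivrMl// mulr1.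
  by rewrite (le_trans tk)// ger_pMr.
apply: ge0_subset_integral => //.
by move=> t /sub_k t01; rewrite lee_fin f10.
Qed.

(** * Monotonicity of rearrangements and the two inequalities *)

Lemma rearrangement_ge0 d (X : measurableType d) (R : realType)
    (mu : {measure set X -> \bar R}) (psi : X -> \bar R) (t : R) :
  (0 <= rearrangement mu psi t)%E.
Proof. by apply: le_ereal_inf_tmp => _ [s [s0 _] <-]; rewrite lee_fin. Qed.

Lemma rearrangement_noninc d (X : measurableType d) (R : realType)
    (mu : {measure set X -> \bar R}) (psi : X -> \bar R) (t u : R) : t <= u ->
  (rearrangement mu psi u <= rearrangement mu psi t)%E.
Proof.
move=> tu; apply: ereal_inf_le_tmp => _ [s [s0 st] <-]; exists s => //; split=> //.
by apply: le_trans st _; rewrite lee_fin.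
Qed.

(** The least exponent m with a^(m+1) <= t works; when it is 0, the upper bound is the assumption t
    < 1. *)
Lemma exists_geometric_cell (R : realType) (a t : R) (N : nat) :
  0 < a -> a ^+ N.+1 <= t -> t < 1 ->
  exists m, [/\ (m <= N)%N, a ^+ m.+1 <= t & t < a ^+ m].
Proof.
move=> a0 aNt t1.
have ex : exists m, a ^+ m.+1 <= t by exists N.
have [m amt mmin] := ex_minnP ex; exists m; split=> //; first exact: mmin.
case: m => [|m] in amt mmin *; first by rewrite expr0.
by rewrite ltNge; apply/negP => /mmin; rewrite ltnn.
Qed.

(* g and h are only constrained on (0, 1] and G on [0, +oo), their domains. The
   rearrangement of the maximal function is finite at every t > 0, so that fine
   loses nothing there, and the point t = 0 does not affect the integrals. *)
Theorem theorem1p1 (R : realType) (d : measure_display) (X : measurableType d)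
    (mu : probability X R) (T : set (set X)) (g h G : R -> R) (k : R)
    (mu_nonatomic : nonatomic mu)
    (T_tree : is_tree mu T)
    (g_ge0 : forall t, t \in `]0, 1] -> 0 <= g t)
    (g_noninc : {in `]0, 1] &, nonincreasing_fun g})
    (g_int : lebesgue_measure.-integrable `]0, 1] (EFin \o g))
    (h_ge0 : forall t, t \in `]0, 1] -> 0 <= h t)
    (h_noninc : {in `]0, 1] &, nonincreasing_fun h})
    (h_int : lebesgue_measure.-integrable `]0, 1] (EFin \o h))
    (G_ge0 : forall y, 0 <= y -> 0 <= G y)
    (G_nondec : {in `[0, +oo[ &, nondecreasing_fun G})
    (k_gt0 : 0 < k) (k_le1 : k <= 1) :
  ereal_sup
    [set v : \bar R | exists (phi : X -> R) (K : set R),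
      [/\ mu.-integrable setT (EFin \o phi),
          forall x, 0 <= phi x,
          {ae lebesgue_measure, forall t : R, t \in `]0, 1] ->
             rearrangement mu (EFin \o phi) t = (g t)%:E},
          [/\ measurable K, K `<=` `[0, 1] & lebesgue_measure K = k%:E] &
          v = (\int[lebesgue_measure]_(t in K)
                (G (fine (rearrangement mu (dyadic_maximal mu T phi) t))
                 * h t)%:E)%E]]
  = (\int[lebesgue_measure]_(t in `]0%R, k])
      (G (t^-1 * \int[lebesgue_measure]_(u in `]0, t]) g u)%R * h t)%:E)%E.
Proof.
pose m : {measure set X -> \bar R} := mu.
have m1 : m setT = 1%E by exact: probability_setT.
have m_fin := mass1_fin_num_fun m1.
have [L TL] := is_tree_filtration (mu := m) T_tree.
pose f t := G (hardy g t) * h t.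
have [f0 fni] := nonincreasing_comp_weight G_ge0 G_nondec h_ge0 h_noninc
  (fun t => @hardy_ge0 R g g_ge0 t) (hardy_noninc g_ge0 g_noninc g_int).
pose rho phi t := fine (rearrangement m (dyadic_maximal m T phi) t).
have rho_ge0 phi t : 0 <= rho phi t by rewrite fine_ge0// rearrangement_ge0.
have rhoP (phi : X -> R) : measurable_fun setT phi -> (forall x, 0 <= phi x) ->
    equidistributed m g phi ->
    [/\ forall t, t \in `]0, 1] ->
         rearrangement m (dyadic_maximal m T phi) t = (rho phi t)%:E,
       forall t, t \in `]0, 1] -> rho phi t <= hardy g t &
       {in `]0, 1] &, nonincreasing_fun (rho phi)}].
  move=> mphi phi0 phig.
  have le_hardy t : t \in `]0, 1] ->
      (rearrangement m (dyadic_maximal m T phi) t <= (hardy g t)%:E)%E.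
    exact: (rearrangement_maximal_le m1 TL).
  have rhoE t : t \in `]0, 1] ->
      rearrangement m (dyadic_maximal m T phi) t = (rho phi t)%:E.
    move=> t01; rewrite fineK// ge0_fin_numE ?rearrangement_ge0//.
    by apply: le_lt_trans (le_hardy _ t01) _; rewrite ltry.
  split=> // [t t01|s t s01 t01 st]; first by rewrite -lee_fin -rhoE// le_hardy.
  by rewrite -lee_fin -!rhoE// rearrangement_noninc.
have weight (phi : X -> R) :
    {in `]0, 1] &, nonincreasing_fun (rho phi)} ->
    (forall t, t \in `]0, 1] -> 0 <= G (rho phi t) * h t) /\
    {in `]0, 1] &, nonincreasing_fun (fun t => G (rho phi t) * h t)}.
  by move=> rho_ni; apply: nonincreasing_comp_weight => // t _; exact: rho_ge0.
apply/eqP; rewrite eq_le; apply/andP; split.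
  apply: ge_ereal_sup => _ [phi [K [iphi phi0 phig [mK K01 muK] ->]]].
  have mphi : measurable_fun setT phi.
    by apply/measurable_EFinP; exact: measurable_int iphi.
  have eqphi : equidistributed m g phi by exact: rearrangement_equidistributed.
  have [_ rho_le rho_ni] := rhoP phi mphi phi0 eqphi.
  have [f10 f1ni] := weight phi rho_ni.
  apply: (integral_le_initial f0 fni _ f1ni) => // t t01.
  rewrite f10//= ler_wpM2r ?h_ge0//; apply: G_nondec; rewrite ?in_itv/= ?andbT//.
    exact: hardy_ge0.
  exact: rho_le.
set S := ereal_sup _.
have mf : measurable_fun (`]0, 1]%classic : set R) (EFin \o f).
  by apply/measurable_EFinP; exact: nonincreasing_in_measurable.
have sub_k : `]0, k]%classic `<=` (`]0, 1]%classic : set R).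
  by move=> t /=; rewrite !in_itv/= => /andP[-> /le_trans->].
have mainN a N : 0 < a < 1 ->
    (a%:E * \int[lebesgue_measure]_(t in `](a ^+ N)%R, k]) (f t)%:E <= S)%E.
  move=> a01; have [a0 a1] := andP a01.
  have TT : T setT.
    by apply: (tree_level_sub TL (n := 0%N)); rewrite (tree_root TL).
  have [V [mV uV cells]] := exists_uniform_cells m_fin TL a01 N TT.
  pose phi x : R := restrict01 g (V x).
  have mphi : measurable_fun setT phi.
    exact: (measurableT_comp (measurable_restrict01 g_noninc) mV).
  have phi0 x : 0 <= phi x by exact: restrict01_ge0.
  have eqphi : equidistributed m g phi by exact: uniform_equidistributed.
  have [rhoE _ rho_ni] := rhoP phi mphi phi0 eqphi.
  have [f10 f1ni] := weight phi rho_ni.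
  apply: (@le_trans _ _ (\int[lebesgue_measure]_(t in `]0%R, k])
      (G (rho phi t) * h t)%:E)%E).
    apply: integral_dilation_le => //; first by rewrite exprn_gt0.
    move=> t /andP[aNt tak].
    have t0 : 0 < t by apply: lt_trans aNt; rewrite mulr_gt0// exprn_gt0.
    have t1 : t < 1.
      by apply: (le_lt_trans tak); apply: (@le_lt_trans _ _ a) => //; rewrite ler_piMr// ltW.
    have aNt' : a ^+ N.+1 <= t by rewrite exprS ltW.
    (* Of the two bounds on t, t < a^i lets the cells of scale i control the rearrangement at t, and
       a^(i+1) <= t puts a^i below t/a, whence [hardy g] at t/a is at most [hardy g (a ^+ i)]. *)
    have [i [iN ait tai]] := exists_geometric_cell a0 aNt' t1.
    have ai01 : a ^+ i \in `]0, 1].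
      by rewrite in_itv/= exprn_gt0//= exprn_ile1// ltW.
    have t01 : t \in `]0, 1] by rewrite in_itv/= t0 ltW.
    have at01 : a^-1 * t \in `]0, 1].
      rewrite in_itv/= mulr_gt0 ?invr_gt0//= ler_pdivrMl// mulr1.
      by rewrite (le_trans tak)// ger_pMr.
    have iat : a ^+ i <= a^-1 * t by rewrite ler_pdivlMl// -exprS.
    have hrho : hardy g (a ^+ i) <= rho phi t.
      rewrite -lee_fin -rhoE//.
      apply: (rearrangement_maximal_ge m1 TL g_ge0 g_noninc g_int mV ai01 tai).
      by have := cells _ iN; rewrite m1 mule1.
    apply: ler_pM; rewrite ?h_ge0 ?G_ge0 ?hardy_ge0//.
      apply: G_nondec; rewrite ?in_itv/= ?andbT ?hardy_ge0//.
      apply: le_trans hrho.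
      exact: (hardy_noninc g_ge0 g_noninc g_int).
    by apply: h_noninc => //; rewrite ler_pdivlMl// ger_pMl// ltW.
  apply: ereal_sup_ubound; exists phi, `]0, k]%classic; split=> //.
  - exact: (uniform_integrable m1 g_ge0 g_noninc g_int mV uV).
  - exact: equidistributed_rearrangement.
  - split; first exact: measurable_itv.
      move=> t /sub_k /=; rewrite !in_itv/= => /andP[t0 ->].
      by rewrite ltW.
    by rewrite lebesgue_measure_itv/= lte_fin k_gt0 oppr0 adde0.
have f0k t : (`]0, k]%classic : set R) t -> (0 <= (f t)%:E)%E.
  by move=> /sub_k t01; rewrite lee_fin f0.
(* Letting a tend to 1 in this form also covers an infinite integral. The supremum [S] depends
   neither on a nor on N, whereas [phi] depends on both. *)
apply/lee_mul01Pr.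
  by apply: integral_ge0 => t tk; exact: f0k.
move=> a a01; have [a0 a1] := andP a01.
pose F N := `](a ^+ N), k]%classic : set R.
have Fk N : F N `<=` `]0, k]%classic.
  move=> t; rewrite /F /= !in_itv/= => /andP[at0 ->]; rewrite andbT.
  by apply: le_lt_trans at0; rewrite exprn_ge0// ltW.
have FE : `]0, k]%classic = \bigcup_N F N.
  apply/seteqP; split=> t; last by move=> [N _ /Fk].
  rewrite /= in_itv/= => /andP[t0 tk].
  have a_cvg : (fun N => a ^+ N) @ \oo --> (0 : R).
    by apply: cvg_expr; rewrite ger0_norm// ltW.
  have [N _ /(_ N (leqnn N)) aNt] := cvgr_lt (0 : R) a_cvg t t0.
  by exists N => //; rewrite /F/= in_itv/= aNt.
(* With a fixed, the intervals (a^N, k] increase to (0, k], so monotone convergence removes the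
   truncation left by the finite depth. *)
have F_cvg : (\int[lebesgue_measure]_(t in F N) (f t)%:E)%E @[N --> \oo] -->
    (\int[lebesgue_measure]_(t in `]0%R, k]) (f t)%:E)%E.
  rewrite FE; apply: ge0_nondecreasing_set_cvg_integral.
  - apply/nondecreasing_seqP => N; apply/subsetPset => t.
    rewrite /F /= !in_itv/= => /andP[at0 ->]; rewrite andbT; apply: le_lt_trans at0.
    by rewrite exprS ger_pMl ?exprn_gt0// ltW.
  - by move=> N; exact: measurable_itv.
  - by move=> N; apply: measurable_funS mf => //; exact: subset_trans (Fk N) sub_k.
  - by move=> N t /Fk; exact: f0k.
have := cvgeZl (y := a%:E) isT F_cvg.
move=> /(cvge_to_le (b := S)); apply; apply: nearW => N /=.
exact: mainN.
Qed.
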